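(* Let $a<b$ be real numbers and let $\gamma:[a,b]\to\mathbb{C}$ be an analytic curve. Let $L>0$ be the length of $\gamma$ on $[a,b]$, let $s_0\in\mathbb{R}$, and let $s:[a,b]\to[s_0,s_0+L]$, $s(t)=s_0+\int_a^t|\gamma'(u)|\,du$, be the arc length function of $\gamma$. Then: (i) there exist an open set $V$ with $[a,b]\subset V\subset\mathbb{C}$ and a conformal mapping $G:V\to\mathbb{C}$ such that $G(t)=s(t)$ for all $t\in[a,b]$; (ii) there exist an open set $\mathcal{O}$ with $[s_0,s_0+L]\subset\mathcal{O}\subset\mathbb{C}$ and a conformal mapping $\delta:\mathcal{O}\to\mathbb{C}$ such that $\gamma(t)=\delta(s(t))$ for all $t\in[a,b]$; moreover $\mathcal{O}$ can be chosen to be a rectangle symmetric with respect to the real axis; (iii) this representation is unique modulo real translations: if $s_0'\in\mathbb{R}$, $\tilde s=s+(s_0'-s_0)$, and $\tilde\delta$ is a conformal mapping on an open set containing $[s_0',s_0'+L]$ with $\gamma=\tilde\delta\circ\tilde s$ on $[a,b]$, then $\tilde\delta(x+s_0'-s_0)=\delta(x)$ for all $x\in[s_0,s_0+L]$.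
   Context: A conformal mapping on an open set $V\subset\mathbb{C}$ is an injective holomorphic function $V\to\mathbb{C}$. A continuous map $\gamma:[a,b]\to\mathbb{C}$, with $a<b$ real, is called an analytic curve if there exist an open set $V\subset\mathbb{C}$ containing $[a,b]$ and a conformal mapping $\phi:V\to\mathbb{C}$ such that $\phi|_{[a,b]}=\gamma$. *)

(* Defs.v *)
From Stdlib Require Import Reals.
From Coquelicot Require Import Coquelicot.
Open Scope R_scope.

(* Functions on a subset of R or C (in particular curves [a,b] -> C) are
   represented by total functions; only their values on that subset matter. *)

Definition conformal_on (V : C -> Prop) (f : C -> C) : Prop :=
  (forall z : C, V z -> @ex_derive C_AbsRing C_NormedModule f z) /\
  (forall z w : C, V z -> V w -> f z = f w -> z = w).

Definition contains_segment (V : C -> Prop) (a b : R) : Prop :=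
  forall x : R, a <= x <= b -> V (RtoC x).

Definition analytic_curve (gamma : R -> C) (a b : R) : Prop :=
  continuous_on (fun t : R => a <= t <= b) gamma /\
  exists (V : C -> Prop) (phi : C -> C),
    open V /\ contains_segment V a b /\ conformal_on V phi /\
    (forall t : R, a <= t <= b -> phi (RtoC t) = gamma t).

(* Length of the polygon inscribed at the n + 2 nodes tau 0, ..., tau (n + 1);
   sum_f_R0 _ n has n + 1 terms. *)
Definition polygon_length (gamma : R -> C) (tau : nat -> R) (n : nat) : R :=
  sum_f_R0 (fun i => Cmod (gamma (tau (S i)) - gamma (tau i))%C) n.

Definition partition (a b : R) (tau : nat -> R) (n : nat) : Prop :=
  tau 0%nat = a /\ tau (S n) = b /\
  (forall i : nat, (i <= n)%nat -> tau i <= tau (S i)).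

Definition curve_length (gamma : R -> C) (a b : R) : Rbar :=
  Lub_Rbar (fun l : R => exists (tau : nat -> R) (n : nat),
    partition a b tau n /\ l = polygon_length gamma tau n).

(* The derivative of a curve given on [a,b] is only meaningful on the open
   interval (a,b) here; the two endpoints do not affect the integral below. *)
Definition velocity (gamma : R -> C) (t : R) : C :=
  (Derive (fun u => Re (gamma u)) t, Derive (fun u => Im (gamma u)) t).

Definition arc_length (gamma : R -> C) (a s0 t : R) : R :=
  s0 + RInt (fun u => Cmod (velocity gamma u)) a t.

Definition symmetric_rectangle (O : C -> Prop) : Prop :=
  exists p q h : R, p < q /\ 0 < h /\
    (forall z : C, O z <-> (p < Re z < q /\ - h < Im z < h)).

(* Main.v *)
Require Import Defs.
From Stdlib Require Import Reals Arith Lra Lia ClassicalEpsilon.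
From Coquelicot Require Import Coquelicot.
Open Scope R_scope.

(** On a real parameter [t] the square of the speed is
    [phi' t * Cconj (phi' (Cconj t))], where [phi] is the conformal extension of
    the curve, and this expression is holomorphic near the segment. Since [phi]
    is injective, [phi'] does not vanish ([injective_derivative_neq_0]), so the
    expression is positive on the segment and has a positive real part on a
    rectangle around it. There its principal square root is holomorphic and
    extends the speed ([speed_extension]); a primitive [G] of it extends the arc
    length, and is injective because the real part of its derivative is positive
    on a convex set ([arc_length_extension]). The image of [G] contains a
    rectangle around the interval of arc lengths, symmetric about the real axis,
    on which [phi] composed with the inverse of [G] is the conformal
    parametrization by arc length ([inverse_on_rectangle]). Uniqueness is
    immediate, as the arc length takes every value between its extreme values.

    That the length, the supremum over inscribed polygons, equals the
    increment of the arc length function is proved by comparing the two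
    over small intervals, with Cousin's principle ([curve_length_speed]).

    The function theory is developed from complex differentiability at points:
    Goursat's theorem for triangles gives primitives on convex sets, and, after
    the change of variable [w = z + e^u], which turns circles into segments,
    Cauchy's formula for the derivative at the centre of a circle
    ([cauchy_derivative]). The mean value property and the holomorphy of the
    derivative follow from it. The nonvanishing of the derivative of an injective
    function is obtained from Harnack's inequality for the logarithm of the
    modulus of its difference quotients ([harnack_ln]), without zero counting. *)

(** * Continuity of complex-valued functions *)

(** [C] carries several uniform structures which are equivalent but not
    convertible; continuity always refers to the product structure of [R * R]. *)
Definition ccont (f : C -> C) (z : C) : Prop :=
  @continuous C_UniformSpace C_UniformSpace f z.
Definition pcont (f : R -> C) (t : R) : Prop :=
  @continuous R_UniformSpace C_UniformSpace f t.

Lemma Cmod_pair_le (z : C) (d : R) :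
  Rabs (fst z) <= d -> Rabs (snd z) <= d -> Cmod z <= 2 * d.
Proof.
  intros H1 H2.
  apply Rle_trans with (1 := Cmod_2Rmax z).
  assert (0 <= d) by (apply Rle_trans with (2 := H1), Rabs_pos).
  assert (Hs : sqrt 2 <= 2).
  { rewrite <- (sqrt_square 2) at 2 by lra. apply sqrt_le_1_alt; lra. }
  apply Rmult_le_compat; try apply sqrt_pos; auto.
  - apply Rle_trans with (2 := Rmax_l _ _), Rabs_pos.
  - now apply Rmax_lub.
Qed.

Lemma Cmod_fst (z : C) : Rabs (fst z) <= Cmod z.
Proof. eapply Rle_trans; [ apply Rmax_l | apply Rmax_Cmod ]. Qed.

Lemma Cmod_snd (z : C) : Rabs (snd z) <= Cmod z.
Proof. eapply Rle_trans; [ apply Rmax_r | apply Rmax_Cmod ]. Qed.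

(** Neighbourhoods are defined by squares; this passes to discs, after which
    every estimate is made with [Cmod]. *)
Lemma locally_Cmod (z : C) (P : C -> Prop) :
  @locally C_UniformSpace z P <->
  exists d, 0 < d /\ forall w, Cmod (w - z) < d -> P w.
Proof.
  split.
  - intros [d Hd]. exists d; split; [ apply cond_pos |].
    intros w Hw. apply Hd. split.
    + eapply Rle_lt_trans; [| exact Hw ]. apply (Cmod_fst (w - z)%C).
    + eapply Rle_lt_trans; [| exact Hw ]. apply (Cmod_snd (w - z)%C).
  - intros [d [Hd H]]. assert (Hd4 : 0 < d / 4) by lra.
    exists (mkposreal _ Hd4). intros w [H1 H2]. apply H.
    apply Rle_lt_trans with (2 * (d / 4)); [| lra ].
    apply Cmod_pair_le; apply Rlt_le; [ exact H1 | exact H2 ].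
Qed.

Lemma continuous_Cmod {T : UniformSpace} (f : T -> C) (x : T) :
  @continuous T C_UniformSpace f x <->
  forall e, 0 < e -> locally x (fun y => Cmod (f y - f x) < e).
Proof.
  split.
  - intros H e He. apply (H (fun w => Cmod (w - f x) < e)).
    apply locally_Cmod. now exists e.
  - intros H P HP. apply locally_Cmod in HP. destruct HP as [d [Hd HP]].
    specialize (H d Hd). revert H.
    apply (filter_imp (F := locally x)). intros y Hy. now apply HP.
Qed.

Lemma ccont_eps (f : C -> C) (z : C) :
  ccont f z <-> forall e, 0 < e ->
    exists d, 0 < d /\ forall w, Cmod (w - z) < d -> Cmod (f w - f z) < e.
Proof.
  unfold ccont. rewrite continuous_Cmod.
  split; intros H e He; apply locally_Cmod; auto.
Qed.

Lemma continuous_pair {T : UniformSpace} (f g : T -> R) (x : T) :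
  continuous f x -> continuous g x ->
  @continuous T C_UniformSpace (fun y => (f y, g y)) x.
Proof.
  intros Hf Hg. apply (continuous_comp_2 f g (fun a b => (a, b)) x Hf Hg).
  apply continuous_ext with (f := fun p : R * R => p).
  - now intros [].
  - apply continuous_id.
Qed.

Lemma continuous_Re {T : UniformSpace} (f : T -> C) (x : T) :
  @continuous T C_UniformSpace f x -> continuous (fun y => Re (f y)) x.
Proof.
  intros Hf. apply (continuous_comp f (fun z : C => Re z) x Hf).
  destruct (f x). apply (continuous_fst (U := R_UniformSpace) (V := R_UniformSpace)).
Qed.

Lemma continuous_Im {T : UniformSpace} (f : T -> C) (x : T) :
  @continuous T C_UniformSpace f x -> continuous (fun y => Im (f y)) x.
Proof.
  intros Hf. apply (continuous_comp f (fun z : C => Im z) x Hf).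
  destruct (f x). apply (continuous_snd (U := R_UniformSpace) (V := R_UniformSpace)).
Qed.

Lemma continuous_Cplus {T : UniformSpace} (f g : T -> C) (x : T) :
  @continuous T C_UniformSpace f x -> @continuous T C_UniformSpace g x ->
  @continuous T C_UniformSpace (fun y => f y + g y)%C x.
Proof. apply (@continuous_plus T R_AbsRing C_R_NormedModule). Qed.

Lemma continuous_Cminus {T : UniformSpace} (f g : T -> C) (x : T) :
  @continuous T C_UniformSpace f x -> @continuous T C_UniformSpace g x ->
  @continuous T C_UniformSpace (fun y => f y - g y)%C x.
Proof. apply (@continuous_minus T R_AbsRing C_R_NormedModule). Qed.

Lemma continuous_Cmult {T : UniformSpace} (f g : T -> C) (x : T) :
  @continuous T C_UniformSpace f x -> @continuous T C_UniformSpace g x ->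
  @continuous T C_UniformSpace (fun y => f y * g y)%C x.
Proof.
  intros Hf Hg.
  apply (continuous_pair (fun y => Re (f y) * Re (g y) - Im (f y) * Im (g y))
                         (fun y => Re (f y) * Im (g y) + Im (f y) * Re (g y))).
  - apply (@continuous_minus T R_AbsRing R_NormedModule);
      apply (@continuous_mult T R_AbsRing); auto using continuous_Re, continuous_Im.
  - apply (@continuous_plus T R_AbsRing R_NormedModule);
      apply (@continuous_mult T R_AbsRing); auto using continuous_Re, continuous_Im.
Qed.

Lemma continuous_Cinv {T : UniformSpace} (f : T -> C) (x : T) :
  @continuous T C_UniformSpace f x -> f x <> 0 ->
  @continuous T C_UniformSpace (fun y => / f y)%C x.
Proof.
  intros Hf H0.
  assert (Hn : Re (f x) * Re (f x) + Im (f x) * Im (f x) <> 0).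
  { intros E. apply H0. destruct (f x) as [u v]. simpl in E.
    unfold RtoC. f_equal; nra. }
  assert (Hc : continuous (fun y => / (Re (f y) * Re (f y) + Im (f y) * Im (f y))) x).
  { apply (continuous_comp _ Rinv); [| now apply continuous_Rinv ].
    apply (@continuous_plus T R_AbsRing R_NormedModule);
      apply (@continuous_mult T R_AbsRing); auto using continuous_Re, continuous_Im. }
  apply continuous_ext with (f := fun y =>
    (Re (f y) * / (Re (f y) * Re (f y) + Im (f y) * Im (f y)),
     - (Im (f y) * / (Re (f y) * Re (f y) + Im (f y) * Im (f y))))).
  - intros y. unfold Cinv, Re, Im. simpl. f_equal.
    + unfold Rdiv. f_equal. f_equal. ring.
    + unfold Rdiv. rewrite <- Ropp_mult_distr_l. do 3 f_equal. ring.
  - apply continuous_pair.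
    + apply (@continuous_mult T R_AbsRing); auto using continuous_Re.
    + apply (@continuous_opp T R_AbsRing R_NormedModule).
      apply (@continuous_mult T R_AbsRing); auto using continuous_Im.
Qed.

Lemma continuous_RtoC {T : UniformSpace} (f : T -> R) (x : T) :
  continuous f x -> @continuous T C_UniformSpace (fun y => RtoC (f y)) x.
Proof.
  intros H. apply continuous_pair; [ exact H | apply continuous_const ].
Qed.

Lemma continuous_Cconj {T : UniformSpace} (f : T -> C) (x : T) :
  @continuous T C_UniformSpace f x ->
  @continuous T C_UniformSpace (fun y => Cconj (f y)) x.
Proof.
  intros H. apply (continuous_pair (fun y => Re (f y)) (fun y => - Im (f y))).
  - now apply continuous_Re.
  - apply (@continuous_opp T R_AbsRing R_NormedModule). now apply continuous_Im.
Qed.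

Lemma norm_Cmod (z : C) : @norm R_AbsRing C_R_NormedModule z = Cmod z.
Proof.
  unfold norm, Cmod; simpl. unfold prod_norm, norm; simpl.
  unfold abs; simpl. f_equal. rewrite !Rmult_1_r, <- !Rabs_mult.
  rewrite !Rabs_pos_eq; try apply Rle_0_sqr; reflexivity.
Qed.

Lemma continuous_mod {T : UniformSpace} (f : T -> C) (x : T) :
  @continuous T C_UniformSpace f x -> continuous (fun y => Cmod (f y)) x.
Proof.
  intros H.
  apply (continuous_comp f (fun z : C => Cmod z) x H).
  apply continuous_ext with (f := fun z : C => @norm R_AbsRing C_R_NormedModule z).
  - exact norm_Cmod.
  - exact (@filterlim_norm R_AbsRing C_R_NormedModule (f x)).
Qed.

(** * Complex derivatives *)

(** Caratheodory's form of complex differentiability: the difference quotient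
    extends continuously to [z]. It turns the rules for products, inverses,
    compositions and reflections into identities between quotients. *)
Definition cderiv (f : C -> C) (z l : C) : Prop :=
  exists q : C -> C,
    (forall w, f w = f z + q w * (w - z))%C /\ q z = l /\ ccont q z.

Lemma Cmod_minus_sym (z w : C) : Cmod (z - w) = Cmod (w - z).
Proof. rewrite <- Cmod_opp. f_equal. ring. Qed.

Lemma Cmod_neq_pos (z w : C) : z <> w -> 0 < Cmod (z - w).
Proof. intros H. apply Cmod_gt_0. now apply Cminus_eq_contra. Qed.

Lemma cderiv_eps (f : C -> C) (z l : C) :
  cderiv f z l <-> forall e, 0 < e -> exists d, 0 < d /\
    forall w, Cmod (w - z) < d ->
      Cmod (f w - f z - l * (w - z)) <= e * Cmod (w - z).
Proof.
  split.
  - intros [q [Hq [Hl Hc]]] e He.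
    apply ccont_eps with (e := e) in Hc; [| exact He ].
    destruct Hc as [d [Hd Hc]]. exists d; split; [ exact Hd |].
    intros w Hw. rewrite (Hq w), <- Hl.
    replace (f z + q w * (w - z) - f z - q z * (w - z))%C
      with ((q w - q z) * (w - z))%C by ring.
    rewrite Cmod_mult. apply Rmult_le_compat_r; [ apply Cmod_ge_0 |].
    now apply Rlt_le, Hc.
  - intros H.
    exists (fun w => if Ceq_dec w z then l else (f w - f z) / (w - z))%C.
    split; [| split ].
    + intros w. destruct (Ceq_dec w z) as [-> | Hw]; [ ring |].
      field. now apply Cminus_eq_contra.
    + destruct (Ceq_dec z z); congruence.
    + apply ccont_eps. intros e He.
      destruct (H (e / 2) ltac:(lra)) as [d [Hd Hw]].
      exists d; split; [ exact Hd |]. intros w Hwd.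
      destruct (Ceq_dec z z) as [_ |]; [| congruence ].
      destruct (Ceq_dec w z) as [-> | Hne].
      * replace (l - l)%C with (RtoC 0) by ring. rewrite Cmod_0. lra.
      * assert (Hp := Cmod_neq_pos _ _ Hne).
        assert (Hn := Cminus_eq_contra _ _ Hne).
        replace ((f w - f z) / (w - z) - l)%C
          with ((f w - f z - l * (w - z)) / (w - z))%C by (field; auto).
        rewrite Cmod_div by auto.
        apply Rle_lt_trans with (e / 2); [| lra ].
        apply Rmult_le_reg_r with (1 := Hp). unfold Rdiv at 1.
        rewrite Rmult_assoc, Rinv_l, Rmult_1_r by lra. now apply Hw.
Qed.

Lemma is_derive_cderiv (f : C -> C) (z l : C) :
  @is_derive C_AbsRing C_NormedModule f z l <-> cderiv f z l.
Proof.
  rewrite cderiv_eps. split.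
  - intros [_ H] e He. specialize (H z).
    assert (Hz : is_filter_lim (@locally (AbsRing_UniformSpace C_AbsRing) z) z)
      by (intros P HP; exact HP).
    specialize (H Hz (mkposreal e He)). simpl in H.
    apply locally_C, locally_Cmod in H. destruct H as [d [Hd H]].
    exists d; split; [ exact Hd |]. intros w Hw. specialize (H w Hw).
    rewrite (Cmult_comm l). exact H.
  - intros H. split; [ apply is_linear_scal_l |].
    intros x Hx.
    assert (x = z) as ->.
    { symmetry.
      exact (@is_filter_lim_locally_unique C_AbsRing
               (AbsRing_NormedModule C_AbsRing) z x Hx). }
    intros [e He]. destruct (H e He) as [d [Hd Hw]].
    apply locally_C, locally_Cmod. exists d; split; [ exact Hd |].
    intros w Hwd. specialize (Hw w Hwd). rewrite (Cmult_comm l) in Hw. exact Hw.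
Qed.

Lemma cderiv_continuous (f : C -> C) (z l : C) : cderiv f z l -> ccont f z.
Proof.
  intros [q [Hq [_ Hc]]].
  apply continuous_ext with (f := fun w => (f z + q w * (w - z))%C).
  - intros w. now rewrite <- Hq.
  - apply continuous_Cplus; [ apply continuous_const |].
    apply continuous_Cmult; [ exact Hc |].
    apply continuous_Cminus; [ apply continuous_id | apply continuous_const ].
Qed.

Lemma cderiv_ext_loc (f g : C -> C) (z l : C) (d : R) :
  0 < d -> (forall w, Cmod (w - z) < d -> f w = g w) ->
  cderiv f z l -> cderiv g z l.
Proof.
  intros Hd Hfg Hf. apply cderiv_eps. intros e He.
  destruct (proj1 (cderiv_eps _ _ _) Hf e He) as [d' [Hd' H]].
  exists (Rmin d d'). split; [ now apply Rmin_glb_lt |].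
  intros w Hw. rewrite <- !Hfg.
  - apply H. eapply Rlt_le_trans; [ exact Hw | apply Rmin_r ].
  - replace (z - z)%C with (RtoC 0) by ring. now rewrite Cmod_0.
  - eapply Rlt_le_trans; [ exact Hw | apply Rmin_l ].
Qed.

Lemma cderiv_ext (f g : C -> C) (z l : C) :
  (forall w, f w = g w) -> cderiv f z l -> cderiv g z l.
Proof. intros H. apply cderiv_ext_loc with (d := 1); [ lra | auto ]. Qed.

Lemma cderiv_const (c z : C) : cderiv (fun _ => c) z 0.
Proof.
  exists (fun _ => RtoC 0). split; [ intros w; ring | split; [ easy |] ].
  apply continuous_const.
Qed.

Lemma cderiv_id (z : C) : cderiv (fun w => w) z 1.
Proof.
  exists (fun _ => RtoC 1). split; [ intros w; ring | split; [ easy |] ].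
  apply continuous_const.
Qed.

Lemma cderiv_plus (f g : C -> C) (z l m : C) :
  cderiv f z l -> cderiv g z m -> cderiv (fun w => f w + g w)%C z (l + m).
Proof.
  intros [p [Hp [<- Hpc]]] [q [Hq [<- Hqc]]].
  exists (fun w => p w + q w)%C. split; [| split; [ easy |] ].
  - intros w. rewrite (Hp w), (Hq w). ring.
  - now apply continuous_Cplus.
Qed.

Lemma cderiv_mult (f g : C -> C) (z l m : C) :
  cderiv f z l -> cderiv g z m ->
  cderiv (fun w => f w * g w)%C z (l * g z + f z * m).
Proof.
  intros Hf Hg. assert (Hc := cderiv_continuous _ _ _ Hg).
  destruct Hf as [p [Hp [<- Hpc]]], Hg as [q [Hq [<- Hqc]]].
  exists (fun w => p w * g w + f z * q w)%C. split; [| split; [ easy |] ].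
  - intros w. rewrite (Hp w), (Hq w). ring.
  - apply continuous_Cplus; apply continuous_Cmult; auto.
    apply continuous_const.
Qed.

Lemma cderiv_scal (c : C) (f : C -> C) (z l : C) :
  cderiv f z l -> cderiv (fun w => c * f w)%C z (c * l).
Proof.
  intros Hf. replace (c * l)%C with (0 * f z + c * l)%C by ring.
  apply (cderiv_mult (fun _ => c)); [ apply cderiv_const | exact Hf ].
Qed.

Lemma cderiv_minus (f g : C -> C) (z l m : C) :
  cderiv f z l -> cderiv g z m -> cderiv (fun w => f w - g w)%C z (l - m).
Proof.
  intros Hf Hg. replace (l - m)%C with (l + (-1) * m)%C by ring.
  apply cderiv_ext with (f := fun w => (f w + (-1) * g w)%C); [ intros w; ring |].
  apply cderiv_plus; [ exact Hf | now apply cderiv_scal ].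
Qed.

Lemma cderiv_shift (f : C -> C) (c z l : C) :
  cderiv f (z + c) l -> cderiv (fun w => f (w + c))%C z l.
Proof.
  intros [p [Hp [<- Hpc]]].
  exists (fun w => p (w + c))%C. split; [| split; [ easy |] ].
  - intros w. rewrite (Hp (w + c)%C). ring.
  - apply (continuous_comp (fun w : C => (w + c)%C) p); [| exact Hpc ].
    apply continuous_Cplus; [ apply continuous_id | apply continuous_const ].
Qed.

Lemma cderiv_comp (f g : C -> C) (z l m : C) :
  cderiv f (g z) l -> cderiv g z m -> cderiv (fun w => f (g w)) z (l * m).
Proof.
  intros Hf Hg. assert (Hc := cderiv_continuous _ _ _ Hg).
  destruct Hf as [p [Hp [<- Hpc]]], Hg as [q [Hq [<- Hqc]]].
  exists (fun w => p (g w) * q w)%C. split; [| split; [ easy |] ].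
  - intros w. rewrite (Hp (g w)). rewrite (Hq w) at 2. ring.
  - apply continuous_Cmult; [| exact Hqc ].
    now apply (continuous_comp g p).
Qed.

Lemma ccont_neq_0 (f : C -> C) (z : C) :
  ccont f z -> f z <> 0 ->
  exists d, 0 < d /\ forall w, Cmod (w - z) < d -> f w <> 0.
Proof.
  intros Hc H0. apply ccont_eps with (e := Cmod (f z)) in Hc;
    [| now apply Cmod_gt_0 ].
  destruct Hc as [d [Hd H]]. exists d; split; [ exact Hd |].
  intros w Hw E. specialize (H w Hw). rewrite E in H.
  replace (0 - f z)%C with (- f z)%C in H by ring.
  rewrite Cmod_opp in H. lra.
Qed.

Lemma cderiv_inv (f : C -> C) (z l : C) :
  cderiv f z l -> f z <> 0 ->
  cderiv (fun w => / f w)%C z (- l / (f z * f z)).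
Proof.
  intros Hf H0. assert (Hc := cderiv_continuous _ _ _ Hf).
  destruct (ccont_neq_0 f z Hc H0) as [d [Hd Hn]].
  destruct Hf as [p [Hp [<- Hpc]]].
  apply cderiv_ext_loc with (d := d)
    (f := fun w => (/ f z + (- p w * / (f w * f z)) * (w - z))%C); [ exact Hd | |].
  - intros w Hw. specialize (Hn w Hw).
    assert (E : (p w * (w - z) = f w - f z)%C) by (rewrite (Hp w); ring).
    replace (/ f z + - p w * / (f w * f z) * (w - z))%C
      with (/ f z - (p w * (w - z)) * / (f w * f z))%C by ring.
    rewrite E. field. auto.
  - exists (fun w => - p w * / (f w * f z))%C. split; [| split; [ easy |] ].
    + intros w. replace (z - z)%C with (RtoC 0) by ring. ring.
    + apply continuous_Cmult.
      * exact (@continuous_opp _ R_AbsRing C_R_NormedModule p z Hpc).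
      * apply continuous_Cinv; [| now apply Cmult_neq_0 ].
        apply continuous_Cmult; [ exact Hc | apply continuous_const ].
Qed.

(** Conjugating both the variable and the value preserves holomorphy; this is
    what makes the square of the speed extend holomorphically off the real axis. *)
Lemma cderiv_reflect (f : C -> C) (z l : C) :
  cderiv f (Cconj z) l -> cderiv (fun w => Cconj (f (Cconj w))) z (Cconj l).
Proof.
  intros [p [Hp [<- Hpc]]].
  exists (fun w => Cconj (p (Cconj w))). split; [| split; [ easy |] ].
  - intros w. rewrite (Hp (Cconj w)), Cplus_conj, Cmult_conj, Cminus_conj.
    now rewrite !Cconj_conj.
  - apply continuous_Cconj. apply (continuous_comp Cconj p); [| exact Hpc ].
    apply (continuous_Cconj (fun w : C => w)), continuous_id.
Qed.

(** * Means of complex functions over the unit interval *)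

(** Segments and circles are all parametrized by [[0,1]], so this single
    integral serves for every contour. *)
Definition mean (f : R -> C) : C := @RInt C_R_CompleteNormedModule f 0 1.
Definition cont01 (f : R -> C) : Prop := forall t, 0 <= t <= 1 -> pcont f t.

Lemma mean_correct (f : R -> C) :
  cont01 f -> @is_RInt C_R_NormedModule f 0 1 (mean f).
Proof.
  intros Hf. apply (@RInt_correct C_R_CompleteNormedModule).
  apply (@ex_RInt_continuous C_R_CompleteNormedModule).
  intros t Ht. rewrite Rmin_left, Rmax_right in Ht by lra. now apply Hf.
Qed.

Lemma mean_unique (f : R -> C) (l : C) :
  @is_RInt C_R_NormedModule f 0 1 l -> mean f = l.
Proof. apply (@is_RInt_unique C_R_CompleteNormedModule). Qed.

Lemma mean_ext (f g : R -> C) :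
  (forall t, 0 <= t <= 1 -> f t = g t) -> mean f = mean g.
Proof.
  intros H. apply (@RInt_ext C_R_CompleteNormedModule f g 0 1).
  intros t Ht. rewrite Rmin_left, Rmax_right in Ht by lra. apply H. lra.
Qed.

Lemma mean_const (c : C) : mean (fun _ => c) = c.
Proof.
  apply mean_unique. assert (H := @is_RInt_const C_R_NormedModule 0 1 c).
  rewrite scal_R_Cmult in H. replace (1 - 0) with 1 in H by ring.
  now rewrite Cmult_1_l in H.
Qed.

Lemma mean_plus (f g : R -> C) :
  cont01 f -> cont01 g -> mean (fun t => f t + g t)%C = (mean f + mean g)%C.
Proof.
  intros Hf Hg. apply mean_unique.
  apply (@is_RInt_plus C_R_NormedModule); now apply mean_correct.
Qed.

Lemma mean_minus (f g : R -> C) :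
  cont01 f -> cont01 g -> mean (fun t => f t - g t)%C = (mean f - mean g)%C.
Proof.
  intros Hf Hg. apply mean_unique.
  apply (@is_RInt_minus C_R_NormedModule); now apply mean_correct.
Qed.

Lemma is_RInt_Re_Im (f : R -> C) (a b : R) (l : C) :
  @is_RInt C_R_NormedModule f a b l <->
  is_RInt (fun t => Re (f t)) a b (Re l) /\ is_RInt (fun t => Im (f t)) a b (Im l).
Proof.
  split.
  - intros H. split.
    + apply (@is_RInt_fct_extend_fst R_NormedModule R_NormedModule f a b l H).
    + apply (@is_RInt_fct_extend_snd R_NormedModule R_NormedModule f a b l H).
  - intros [H1 H2]. destruct l as [u v].
    exact (@is_RInt_fct_extend_pair R_NormedModule R_NormedModule f a b u v H1 H2).
Qed.

Lemma is_RInt_Cscal (c : C) (f : R -> C) (a b : R) (l : C) :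
  @is_RInt C_R_NormedModule f a b l ->
  @is_RInt C_R_NormedModule (fun t => c * f t)%C a b (c * l)%C.
Proof.
  rewrite !is_RInt_Re_Im. intros [H1 H2]. split.
  - exact (@is_RInt_minus R_NormedModule _ _ a b _ _
             (@is_RInt_scal R_NormedModule _ a b (Re c) _ H1)
             (@is_RInt_scal R_NormedModule _ a b (Im c) _ H2)).
  - exact (@is_RInt_plus R_NormedModule _ _ a b _ _
             (@is_RInt_scal R_NormedModule _ a b (Re c) _ H2)
             (@is_RInt_scal R_NormedModule _ a b (Im c) _ H1)).
Qed.

Lemma mean_scal (c : C) (f : R -> C) :
  cont01 f -> mean (fun t => c * f t)%C = (c * mean f)%C.
Proof.
  intros Hf. apply mean_unique, is_RInt_Cscal. now apply mean_correct.
Qed.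

Lemma mean_Re (f : R -> C) : cont01 f -> is_RInt (fun t => Re (f t)) 0 1 (Re (mean f)).
Proof. intros Hf. exact (proj1 (proj1 (is_RInt_Re_Im f 0 1 _) (mean_correct f Hf))). Qed.

Lemma mean_conj (f : R -> C) :
  cont01 f -> mean (fun t => Cconj (f t)) = Cconj (mean f).
Proof.
  intros Hf. apply mean_unique, is_RInt_Re_Im.
  destruct (proj1 (is_RInt_Re_Im f 0 1 _) (mean_correct f Hf)) as [H1 H2].
  split; [ exact H1 |].
  exact (@is_RInt_opp R_NormedModule _ 0 1 _ H2).
Qed.

Lemma mean_le (f : R -> C) (g : R -> R) (m : R) :
  cont01 f -> (forall t, 0 <= t <= 1 -> Cmod (f t) <= g t) ->
  is_RInt g 0 1 m -> Cmod (mean f) <= m.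
Proof.
  intros Hf Hg Hm. rewrite <- norm_Cmod.
  apply (@norm_RInt_le C_R_NormedModule f g 0 1); auto; [ lra | | now apply mean_correct ].
  intros t Ht. rewrite norm_Cmod. auto.
Qed.

Lemma is_RInt_const_01 (m : R) : is_RInt (fun _ => m) 0 1 m.
Proof.
  assert (H := @is_RInt_const R_NormedModule 0 1 m).
  change (scal (1 - 0) m) with ((1 - 0) * m) in H.
  now rewrite Rminus_0_r, Rmult_1_l in H.
Qed.

Lemma mean_le_const (f : R -> C) (m : R) :
  cont01 f -> (forall t, 0 <= t <= 1 -> Cmod (f t) <= m) -> Cmod (mean f) <= m.
Proof.
  intros Hf Hm. apply (mean_le f (fun _ => m)); auto using is_RInt_const_01.
Qed.

Lemma mean_near (f : R -> C) (c : C) (m : R) :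
  cont01 f -> (forall t, 0 <= t <= 1 -> Cmod (f t - c) <= m) -> Cmod (mean f - c) <= m.
Proof.
  intros Hf Hm. rewrite <- (mean_const c) at 1. rewrite <- mean_minus; auto.
  - apply mean_le_const; auto. intros t Ht.
    apply continuous_Cminus; [ now apply Hf | apply continuous_const ].
  - intros t _. apply continuous_const.
Qed.

(** * Sequences with geometrically decreasing increments *)

(* Equations obtained by unfolding module operations are typed in the carrier
   of a structure on [C]; [ring] needs the type [C] itself. *)
Ltac ceq := match goal with |- @eq _ ?x ?y => change (@eq C x y) end.

(** The intervals of radius [2 * M / 2 ^ n] around [u n] are nested, and the
    limit is their common point. *)
Lemma geometric_limit_R (u : nat -> R) (M : R) :
  (forall n, Rabs (u (S n) - u n) <= M / 2 ^ n) ->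
  exists l, forall n, Rabs (u n - l) <= 2 * M / 2 ^ n.
Proof.
  intros H.
  assert (Hp : forall n, 0 < 2 ^ n) by (intros; apply pow_lt; lra).
  assert (HS : forall n, M / 2 ^ n = 2 * (M / 2 ^ S n)).
  { intros n. simpl. specialize (Hp n). field. lra. }
  set (lo := fun n => u n - 2 * M / 2 ^ n).
  set (hi := fun n => u n + 2 * M / 2 ^ n).
  assert (Hstep : forall n, lo n <= lo (S n) /\ hi (S n) <= hi n).
  { intros n. unfold lo, hi. specialize (H n). apply Rabs_le_between in H.
    specialize (HS n). unfold Rdiv in *. lra. }
  assert (HM : forall n, 0 <= 2 * M / 2 ^ n).
  { intros n. specialize (H n). assert (Ha := Rabs_pos (u (S n) - u n)).
    unfold Rdiv in *. lra. }
  assert (Hadd : forall n k, lo n <= lo (n + k)%nat /\ hi (n + k)%nat <= hi n).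
  { intros n k. induction k as [| k IH].
    - rewrite Nat.add_0_r. lra.
    - rewrite Nat.add_succ_r. specialize (Hstep (n + k)%nat). lra. }
  assert (Hlh : forall n m, lo n <= hi m).
  { intros n m.
    destruct (Hadd n m) as [H1 _], (Hadd m n) as [_ H2].
    rewrite (Nat.add_comm m n) in H2. specialize (HM (n + m)%nat).
    unfold lo, hi in *. lra. }
  destruct (completeness (fun x => exists n, x = lo n)) as [l [Hub Hlub]].
  - exists (hi 0%nat). intros x [n ->]. apply Hlh.
  - now exists (lo 0%nat), 0%nat.
  - exists l. intros n. apply Rabs_le_between.
    assert (H1 : lo n <= l) by (apply Hub; now exists n).
    assert (H2 : l <= hi n) by (apply Hlub; intros x [m ->]; apply Hlh).
    unfold lo, hi in *. lra.
Qed.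

Lemma geometric_limit (u : nat -> C) (M : R) :
  (forall n, Cmod (u (S n) - u n) <= M / 2 ^ n) ->
  exists l, forall n, Cmod (u n - l) <= 4 * M / 2 ^ n.
Proof.
  intros H.
  destruct (geometric_limit_R (fun n => Re (u n)) M) as [x Hx].
  { intros n. eapply Rle_trans; [ apply (Cmod_fst (u (S n) - u n)%C) | apply H ]. }
  destruct (geometric_limit_R (fun n => Im (u n)) M) as [y Hy].
  { intros n. eapply Rle_trans; [ apply (Cmod_snd (u (S n) - u n)%C) | apply H ]. }
  exists (x, y). intros n.
  replace (4 * M / 2 ^ n) with (2 * (2 * M / 2 ^ n)) by (unfold Rdiv; ring).
  apply Cmod_pair_le; [ apply Hx | apply Hy ].
Qed.

(** * Integrals along segments *)

(** The contour integral of [f] along the segment from [p] to [q]. *)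
Definition seg (f : C -> C) (p q : C) : C :=
  ((q - p) * mean (fun t => f (p + RtoC t * (q - p))))%C.

Definition seg_cont (f : C -> C) (p q : C) : Prop :=
  forall t, 0 <= t <= 1 -> ccont f (p + RtoC t * (q - p)).

Lemma continuous_affine (p q : C) (t : R) :
  pcont (fun t => (p + RtoC t * q)%C) t.
Proof.
  apply continuous_Cplus; [ apply continuous_const |].
  apply continuous_Cmult; [| apply continuous_const ].
  apply (continuous_RtoC (fun t : R => t)), continuous_id.
Qed.

Lemma seg_cont01 (f : C -> C) (p q : C) :
  seg_cont f p q -> cont01 (fun t => f (p + RtoC t * (q - p))%C).
Proof.
  intros H t Ht.
  apply (continuous_comp (fun t => (p + RtoC t * (q - p))%C) f);
    [ apply continuous_affine | now apply H ].
Qed.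

Lemma mean_reverse (f : R -> C) :
  cont01 f -> mean (fun t => f (1 - t)) = mean f.
Proof.
  intros Hf. apply mean_unique.
  assert (H := @is_RInt_comp_lin C_R_NormedModule f (-1) 1 0 1 (Copp (mean f))).
  replace (-1 * 0 + 1) with 1 in H by ring.
  replace (-1 * 1 + 1) with 0 in H by ring.
  specialize (H (@is_RInt_swap C_R_NormedModule f 1 0 _ (mean_correct f Hf))).
  apply (is_RInt_Cscal (-1)) in H.
  replace (RtoC (-1) * - mean f)%C with (mean f) in H by ring.
  eapply (@is_RInt_ext C_R_NormedModule); [| exact H ].
  intros t _. cbv beta. rewrite scal_R_Cmult. replace (-1 * t + 1) with (1 - t) by ring.
  ceq. ring.
Qed.

Lemma mean_halves (f : R -> C) :
  cont01 f ->
  (mean (fun t => f (t / 2)%R) + mean (fun t => f ((1 + t) / 2)%R) = 2 * mean f)%C.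
Proof.
  intros Hf.
  assert (Hc : forall a b, 0 <= a -> a <= b -> b <= 1 ->
    @ex_RInt C_R_NormedModule f a b).
  { intros a b H0 H1 H2. apply (@ex_RInt_continuous C_R_CompleteNormedModule).
    intros t Ht. rewrite Rmin_left, Rmax_right in Ht by lra. apply Hf. lra. }
  destruct (Hc 0 (1/2)) as [l Hl]; try lra.
  destruct (Hc (1/2) 1) as [m Hm]; try lra.
  assert (E : mean f = (l + m)%C).
  { apply mean_unique.
    exact (@is_RInt_Chasles C_R_NormedModule f 0 (1/2) 1 l m Hl Hm). }
  assert (El : mean (fun t => f (t / 2)) = (2 * l)%C).
  { apply mean_unique.
    assert (H := @is_RInt_comp_lin C_R_NormedModule f (1/2) 0 0 1 l).
    replace (1 / 2 * 0 + 0) with 0 in H by field.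
    replace (1 / 2 * 1 + 0) with (1 / 2) in H by field.
    specialize (H Hl). apply (is_RInt_Cscal 2) in H.
    eapply (@is_RInt_ext C_R_NormedModule); [| exact H ].
    intros t _. cbv beta. rewrite scal_R_Cmult. replace (1 / 2 * t + 0) with (t / 2) by field.
    rewrite Cmult_assoc, <- RtoC_mult. replace (2 * (1 / 2)) with 1 by field.
    apply Cmult_1_l. }
  assert (Em : mean (fun t => f ((1 + t) / 2)) = (2 * m)%C).
  { apply mean_unique.
    assert (H := @is_RInt_comp_lin C_R_NormedModule f (1/2) (1/2) 0 1 m).
    replace (1 / 2 * 0 + 1 / 2) with (1 / 2) in H by field.
    replace (1 / 2 * 1 + 1 / 2) with 1 in H by field.
    specialize (H Hm). apply (is_RInt_Cscal 2) in H.
    eapply (@is_RInt_ext C_R_NormedModule); [| exact H ].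
    intros t _. cbv beta. rewrite scal_R_Cmult.
    replace (1 / 2 * t + 1 / 2) with ((1 + t) / 2) by field.
    rewrite Cmult_assoc, <- RtoC_mult. replace (2 * (1 / 2)) with 1 by field.
    apply Cmult_1_l. }
  rewrite E, El, Em. ring.
Qed.

Lemma seg_sym (f : C -> C) (p q : C) :
  seg_cont f p q -> seg f q p = (- seg f p q)%C.
Proof.
  intros H. unfold seg.
  rewrite <- (mean_reverse (fun t => f (p + RtoC t * (q - p))%C))
    by now apply seg_cont01.
  rewrite (mean_ext (fun t => f (q + RtoC t * (p - q))%C)
    (fun t => f (p + RtoC (1 - t) * (q - p))%C)).
  - ring.
  - intros t _. f_equal. rewrite RtoC_minus. ring.
Qed.

Definition mid (p q : C) : C := ((p + q) / 2)%C.

Lemma two_neq_0 : RtoC 2 <> 0.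
Proof. intros H. apply RtoC_inj in H. lra. Qed.

Lemma seg_mid (f : C -> C) (p q : C) :
  seg_cont f p q -> seg f p q = (seg f p (mid p q) + seg f (mid p q) q)%C.
Proof.
  intros H. unfold seg.
  assert (Hh := mean_halves _ (seg_cont01 f p q H)). cbv beta in Hh.
  rewrite (mean_ext (fun t => f (p + RtoC t * (mid p q - p))%C)
    (fun t => f (p + RtoC (t / 2) * (q - p))%C)).
  2:{ intros t _. f_equal. rewrite RtoC_div by lra. unfold mid. field. }
  rewrite (mean_ext (fun t => f (mid p q + RtoC t * (q - mid p q))%C)
    (fun t => f (p + RtoC ((1 + t) / 2) * (q - p))%C)).
  2:{ intros t _. f_equal. rewrite RtoC_div, RtoC_plus by lra. unfold mid. field. }
  replace (mid p q - p)%C with ((q - p) / 2)%C by (unfold mid; field).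
  replace (q - mid p q)%C with ((q - p) / 2)%C by (unfold mid; field).
  rewrite <- Cmult_plus_distr_l, Hh. field.
Qed.

Lemma seg_minus (f g : C -> C) (p q : C) :
  seg_cont f p q -> seg_cont g p q ->
  seg (fun w => f w - g w)%C p q = (seg f p q - seg g p q)%C.
Proof.
  intros Hf Hg. unfold seg.
  rewrite (mean_minus _ _ (seg_cont01 f p q Hf) (seg_cont01 g p q Hg)). ring.
Qed.

Lemma mean_id : mean RtoC = (/ 2)%C.
Proof.
  assert (Hc : cont01 RtoC).
  { intros t _. apply (continuous_RtoC (fun t : R => t)), continuous_id. }
  assert (H := mean_reverse _ Hc).
  rewrite (mean_ext _ (fun t => 1 - RtoC t)%C) in H.
  - rewrite mean_minus, mean_const in H; auto.
    + assert (E : (mean RtoC + mean RtoC = 1)%C).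
      { rewrite <- H at 1. ring. }
      apply (f_equal (fun z => z / 2)%C) in E.
      transitivity (1 / 2)%C; [| field ].
      rewrite <- E. field.
    + intros t _. apply continuous_const.
  - intros t _. now rewrite RtoC_minus.
Qed.

Lemma seg_affine (u v p q : C) :
  seg (fun w => u + v * w)%C p q = (u * (q - p) + v * (q * q - p * p) / 2)%C.
Proof.
  unfold seg.
  rewrite (mean_ext _ (fun t => (u + v * p) + v * (q - p) * RtoC t)%C)
    by (intros; ring).
  assert (Hc : cont01 RtoC).
  { intros t _. apply (continuous_RtoC (fun t : R => t)), continuous_id. }
  rewrite mean_plus, mean_const, mean_scal, mean_id; auto.
  - field.
  - intros t _. apply continuous_const.
  - intros t Ht. apply continuous_Cmult; [ apply continuous_const | now apply Hc ].
Qed.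

Lemma seg_le (f : C -> C) (p q : C) (m : R) :
  seg_cont f p q ->
  (forall t, 0 <= t <= 1 -> Cmod (f (p + RtoC t * (q - p))%C) <= m) ->
  Cmod (seg f p q) <= Cmod (q - p) * m.
Proof.
  intros Hf Hm. unfold seg. rewrite Cmod_mult.
  apply Rmult_le_compat_l; [ apply Cmod_ge_0 |].
  apply mean_le_const; [ now apply seg_cont01 | exact Hm ].
Qed.

(** * Goursat's theorem for triangles *)

Definition convex (K : C -> Prop) : Prop :=
  forall p q t, K p -> K q -> 0 <= t <= 1 -> K (p + RtoC t * (q - p))%C.
Definition seq_closed (K : C -> Prop) : Prop :=
  forall z, (forall e, 0 < e -> exists w, K w /\ Cmod (w - z) < e) -> K z.
Definition holo (f : C -> C) (z : C) : Prop := exists l, cderiv f z l.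

Lemma holo_continuous (f : C -> C) (z : C) : holo f z -> ccont f z.
Proof. intros [l H]. now apply cderiv_continuous with l. Qed.

Lemma holo_seg_cont (K : C -> Prop) (f : C -> C) (p q : C) :
  convex K -> (forall z, K z -> holo f z) -> K p -> K q -> seg_cont f p q.
Proof. intros HK Hf Hp Hq t Ht. apply holo_continuous. auto. Qed.

Definition triangle : Type := (C * C * C)%type.
Definition tri (f : C -> C) (T : triangle) : C :=
  let '(a, b, c) := T in (seg f a b + seg f b c + seg f c a)%C.
Definition perimeter (T : triangle) : R :=
  let '(a, b, c) := T in Cmod (b - a) + Cmod (c - b) + Cmod (a - c).
Definition apex (T : triangle) : C := fst (fst T).
Definition inside (K : C -> Prop) (T : triangle) : Prop :=
  let '(a, b, c) := T in K a /\ K b /\ K c.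

(** One of the four triangles cut out by the midpoints, with an integral at
    least a quarter of the original in modulus. By the triangle inequality the
    last triangle qualifies when the other three do not. *)
Definition quarter (f : C -> C) (T : triangle) : triangle :=
  let '(a, b, c) := T in
  let T1 := (a, mid a b, mid c a) in
  let T2 := (mid a b, b, mid b c) in
  let T3 := (mid c a, mid b c, c) in
  let T4 := (mid a b, mid b c, mid c a) in
  let big S := Rle_dec (Cmod (tri f T) / 4) (Cmod (tri f S)) in
  if big T1 then T1 else if big T2 then T2 else if big T3 then T3 else T4.

Lemma Cmod_half (z w : C) : (w = z / 2)%C -> Cmod w = Cmod z / 2.
Proof.
  intros ->. rewrite Cmod_div by apply two_neq_0.
  rewrite Cmod_R, Rabs_pos_eq; lra.
Qed.

Lemma convex_mid (K : C -> Prop) (p q : C) : convex K -> K p -> K q -> K (mid p q).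
Proof.
  intros HK Hp Hq. replace (mid p q) with (p + RtoC (/ 2) * (q - p))%C.
  - apply HK; auto; lra.
  - unfold mid. rewrite RtoC_inv by lra. field.
Qed.

(** The three inner sides are traversed once in each direction. *)
Lemma tri_subdivide (K : C -> Prop) (f : C -> C) (a b c : C) :
  convex K -> (forall z, K z -> holo f z) -> K a -> K b -> K c ->
  (tri f (a, b, c) = tri f (a, mid a b, mid c a) + tri f (mid a b, b, mid b c)
     + tri f (mid c a, mid b c, c) + tri f (mid a b, mid b c, mid c a))%C.
Proof.
  intros HK Hf Ha Hb Hc.
  assert (Hab := convex_mid K a b HK Ha Hb).
  assert (Hbc := convex_mid K b c HK Hb Hc).
  assert (Hca := convex_mid K c a HK Hc Ha).
  assert (HS : forall p q, K p -> K q -> seg_cont f p q)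
    by (intros; now apply (holo_seg_cont K)).
  unfold tri.
  rewrite (seg_mid f a b), (seg_mid f b c), (seg_mid f c a) by auto.
  rewrite (seg_sym f (mid a b) (mid c a)), (seg_sym f (mid a b) (mid b c)),
    (seg_sym f (mid b c) (mid c a)) by auto.
  ring.
Qed.

Lemma quarter_spec (K : C -> Prop) (f : C -> C) (T : triangle) :
  convex K -> (forall z, K z -> holo f z) -> inside K T ->
  inside K (quarter f T) /\ perimeter (quarter f T) = perimeter T / 2 /\
  Cmod (tri f T) / 4 <= Cmod (tri f (quarter f T)) /\
  Cmod (apex (quarter f T) - apex T) <= perimeter T.
Proof.
  destruct T as [[a b] c]. intros HK Hf [Ha [Hb Hc]].
  assert (Hab := convex_mid K a b HK Ha Hb).
  assert (Hbc := convex_mid K b c HK Hb Hc).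
  assert (Hca := convex_mid K c a HK Hc Ha).
  assert (E := tri_subdivide K f a b c HK Hf Ha Hb Hc).
  assert (P1 := Cmod_ge_0 (b - a)). assert (P2 := Cmod_ge_0 (c - b)).
  assert (P3 := Cmod_ge_0 (a - c)).
  assert (Hper : forall x y z, (x = (b - a) / 2)%C -> (y = (c - b) / 2)%C ->
    (z = (a - c) / 2)%C -> Cmod x + Cmod y + Cmod z =
      (Cmod (b - a) + Cmod (c - b) + Cmod (a - c)) / 2).
  { intros x y z Hx Hy Hz.
    rewrite (Cmod_half _ _ Hx), (Cmod_half _ _ Hy), (Cmod_half _ _ Hz). lra. }
  assert (H0 : Cmod (a - a) = 0)
    by (replace (a - a)%C with (RtoC 0) by ring; apply Cmod_0).
  assert (H1 : Cmod (mid a b - a) = Cmod (b - a) / 2)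
    by (apply Cmod_half; unfold mid; field).
  assert (H2 : Cmod (mid c a - a) = Cmod (a - c) / 2)
    by (rewrite (Cmod_minus_sym a c); apply Cmod_half; unfold mid; field).
  set (T := (a, b, c)). set (T1 := (a, mid a b, mid c a)).
  set (T2 := (mid a b, b, mid b c)). set (T3 := (mid c a, mid b c, c)).
  set (T4 := (mid a b, mid b c, mid c a)).
  fold T T1 T2 T3 T4 in E.
  assert (Good : forall S, S = T1 \/ S = T2 \/ S = T3 \/ S = T4 ->
    inside K S /\ perimeter S = perimeter T / 2 /\
    Cmod (apex S - apex T) <= perimeter T).
  { intros S [-> | [-> | [-> | ->]]]; (split; [ now simpl | split ]);
      unfold T, T1, T2, T3, T4, perimeter, apex; simpl fst; try lra.
    - apply Hper; unfold mid; field.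
    - apply Hper; unfold mid; field.
    - apply Hper; unfold mid; field.
    - rewrite (Cmod_minus_sym (mid b c) (mid a b)),
        (Cmod_minus_sym (mid c a) (mid b c)), (Cmod_minus_sym (mid a b) (mid c a)).
      rewrite <- (Hper (mid b c - mid c a)%C (mid c a - mid a b)%C
        (mid a b - mid b c)%C); [ ring | | |]; unfold mid; field. }
  assert (Hbig : Cmod (tri f T) <=
    Cmod (tri f T1) + Cmod (tri f T2) + Cmod (tri f T3) + Cmod (tri f T4)).
  { rewrite E. eapply Rle_trans; [ apply Cmod_triangle |]. apply Rplus_le_compat_r.
    eapply Rle_trans; [ apply Cmod_triangle |]. apply Rplus_le_compat_r.
    apply Cmod_triangle. }
  assert (Hq : let S := quarter f T in
    (S = T1 \/ S = T2 \/ S = T3 \/ S = T4) /\ Cmod (tri f T) / 4 <= Cmod (tri f S)).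
  { change (quarter f T) with
      (if Rle_dec (Cmod (tri f T) / 4) (Cmod (tri f T1)) then T1 else
       if Rle_dec (Cmod (tri f T) / 4) (Cmod (tri f T2)) then T2 else
       if Rle_dec (Cmod (tri f T) / 4) (Cmod (tri f T3)) then T3 else T4).
    cbv zeta.
    destruct (Rle_dec _ (Cmod (tri f T1))) as [r | n1]; [ split; [ now left | exact r ] |].
    destruct (Rle_dec _ (Cmod (tri f T2))) as [r | n2];
      [ split; [ now right; left | exact r ] |].
    destruct (Rle_dec _ (Cmod (tri f T3))) as [r | n3];
      [ split; [ now right; right; left | exact r ] |].
    split; [ now right; right; right | lra ]. }
  destruct Hq as [Hq1 Hq2]. destruct (Good _ Hq1) as [G1 [G2 G3]]. auto.
Qed.

(** Quadrisection: the chosen triangles shrink to a point, near which [f] is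
    affine up to an error small compared with the perimeter. Integrals of affine
    functions around triangles vanish, so the integral over the [n]-th triangle
    is small compared with [perimeter ^ 2], that is with [1 / 4 ^ n], while it
    is at least the original integral divided by [4 ^ n]. *)
Lemma goursat (K : C -> Prop) (f : C -> C) (a b c : C) :
  convex K -> seq_closed K -> (forall z, K z -> holo f z) ->
  K a -> K b -> K c -> (seg f a b + seg f b c + seg f c a = 0)%C.
Proof.
  intros HK Hcl Hf Ha Hb Hc.
  set (T := fun n => Nat.iter n (quarter f) (a, b, c)).
  set (p := perimeter (a, b, c)).
  assert (Hp2 : forall n, 0 < 2 ^ n) by (intros; apply pow_lt; lra).
  assert (HT : forall n, inside K (T n) /\ perimeter (T n) = p / 2 ^ n /\
    Cmod (tri f (a, b, c)) / 4 ^ n <= Cmod (tri f (T n))).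
  { induction n as [| n [I1 [I2 I3]]].
    - split; [ now simpl |]. change (T 0%nat) with (a, b, c).
      fold p. rewrite !pow_O. lra.
    - destruct (quarter_spec K f (T n) HK Hf I1) as [J1 [J2 [J3 _]]].
      change (T (S n)) with (quarter f (T n)).
      split; [ exact J1 | split ].
      + rewrite J2, I2. simpl. specialize (Hp2 n). field. lra.
      + eapply Rle_trans; [| exact J3 ].
        assert (0 < 4 ^ n) by (apply pow_lt; lra).
        replace (Cmod (tri f (a, b, c)) / 4 ^ S n)
          with (Cmod (tri f (a, b, c)) / 4 ^ n / 4) by (simpl; field; lra).
        lra. }
  destruct (geometric_limit (fun n => apex (T n)) p) as [z Hz].
  { intros n. destruct (HT n) as [I1 [I2 _]].
    destruct (quarter_spec K f (T n) HK Hf I1) as [_ [_ [_ J]]].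
    rewrite <- I2. exact J. }
  (* A point of the [n]-th triangle is at most [6 * p / 2 ^ n] away from the
     limit [z] of the apices: a side, the distance from its origin to the apex,
     and the [4 * p / 2 ^ n] of [geometric_limit]. *)
  assert (Hsmall : forall d, 0 < d -> exists n, 6 * p / 2 ^ n < d).
  { intros d Hd.
    assert (Hp : 0 <= p).
    { unfold p, perimeter. assert (P1 := Cmod_ge_0 (b - a)).
      assert (P2 := Cmod_ge_0 (c - b)). assert (P3 := Cmod_ge_0 (a - c)). lra. }
    destruct (pow_lt_1_zero (/ 2) ltac:(rewrite Rabs_pos_eq; lra)
      (d / (6 * p + 1)) ltac:(apply Rdiv_lt_0_compat; lra)) as [n Hn].
    exists n. specialize (Hn n (Nat.le_refl n)).
    rewrite Rabs_pos_eq in Hn by (apply pow_le; lra).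
    rewrite pow_inv in Hn. specialize (Hp2 n).
    assert (0 < / 2 ^ n) by now apply Rinv_0_lt_compat.
    apply Rmult_lt_compat_r with (r := 6 * p + 1) in Hn; [| lra ].
    replace (d / (6 * p + 1) * (6 * p + 1)) with d in Hn by (field; lra).
    unfold Rdiv. nra. }
  assert (HKz : K z).
  { apply Hcl. intros e He. destruct (Hsmall e He) as [n Hn].
    exists (apex (T n)). destruct (HT n) as [I1 [I2 _]]. split.
    - destruct (T n) as [[x y] w]. apply I1.
    - specialize (Hz n). destruct (HT 0%nat) as [_ [I3 _]].
      assert (0 <= p / 2 ^ n).
      { rewrite <- I2. destruct (T n) as [[x y] w]. unfold perimeter.
        assert (P1 := Cmod_ge_0 (y - x)). assert (P2 := Cmod_ge_0 (w - y)).
        assert (P3 := Cmod_ge_0 (x - w)). lra. }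
      unfold Rdiv in *. lra. }
  destruct (Hf z HKz) as [l Hl].
  assert (HfK : forall u v, K u -> K v -> seg_cont f u v)
    by (intros; now apply (holo_seg_cont K)).
  apply Cmod_eq_0, Rle_antisym; [| apply Cmod_ge_0 ].
  apply le_epsilon. intros eps Heps. rewrite Rplus_0_l.
  set (e := eps / (6 * (p * p) + 1)).
  assert (Hpp : 0 <= p * p) by apply Rle_0_sqr.
  assert (He : 0 < e) by (apply Rdiv_lt_0_compat; lra).
  destruct (proj1 (cderiv_eps _ _ _) Hl e He) as [d [Hd Hlin]].
  destruct (Hsmall d Hd) as [n Hn].
  destruct (HT n) as [I1 [I2 I3]]. specialize (Hz n).
  (* The affine approximation of [f] at [z], and below the remainder [r]. *)
  set (g := fun w => ((f z - l * z) + l * w)%C).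
  assert (Hg : forall u v, seg_cont g u v).
  { intros u v t _. apply continuous_Cplus; [ apply continuous_const |].
    apply continuous_Cmult; [ apply continuous_const | apply continuous_id ]. }
  set (r := fun w => (f w - g w)%C).
  set (P := p / 2 ^ n) in *.
  assert (Hr : forall u v, K u -> K v -> Cmod (v - u) <= P ->
    Cmod (u - apex (T n)) <= P -> Cmod (seg r u v) <= Cmod (v - u) * (e * (6 * P))).
  { intros u v Hu Hv H1 H2. apply seg_le.
    - intros t Ht. apply continuous_Cminus; [ now apply HfK | now apply Hg ].
    - intros t Ht. set (w := (u + RtoC t * (v - u))%C).
      assert (Hw : Cmod (w - z) <= 6 * P).
      { replace (w - z)%C
          with (RtoC t * (v - u) + ((u - apex (T n)) + (apex (T n) - z)))%C
          by (unfold w; ring).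
        eapply Rle_trans; [ apply Cmod_triangle |].
        assert (H3 := Cmod_triangle (u - apex (T n)) (apex (T n) - z)).
        rewrite Cmod_mult, Cmod_R, Rabs_pos_eq by lra.
        assert (H4 := Cmod_ge_0 (v - u)).
        assert (t * Cmod (v - u) <= P) by nra.
        unfold P, Rdiv in *. lra. }
      unfold r, g. replace (f w - (f z - l * z + l * w))%C
        with (f w - f z - l * (w - z))%C by ring.
      eapply Rle_trans; [ apply Hlin | apply Rmult_le_compat_l; lra ].
      unfold P, Rdiv in *. lra. }
  assert (Htri : Cmod (tri f (T n)) <= P * (e * (6 * P))).
  { destruct (T n) as [[x y] w]. unfold perimeter in I2. unfold apex in Hr.
    simpl fst in Hr. destruct I1 as [Kx [Ky Kw]].
    assert (P1 := Cmod_ge_0 (y - x)). assert (P2 := Cmod_ge_0 (w - y)).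
    assert (P3 := Cmod_ge_0 (x - w)).
    assert (Hseg : forall u v, K u -> K v ->
      seg f u v = (seg r u v + seg g u v)%C).
    { intros u v Hu Hv. unfold r. rewrite seg_minus by auto. ring. }
    unfold tri. rewrite !Hseg by auto. unfold g. rewrite !seg_affine.
    match goal with |- Cmod ?v <= _ =>
      replace v with (seg r x y + seg r y w + seg r w x)%C by field end.
    eapply Rle_trans; [ apply Cmod_triangle |].
    eapply Rle_trans; [ apply Rplus_le_compat_r, Cmod_triangle |].
    assert (Cmod (x - x) = 0)
      by (replace (x - x)%C with (RtoC 0) by ring; apply Cmod_0).
    rewrite (Cmod_minus_sym x w) in *.
    assert (S1 := Hr x y Kx Ky ltac:(lra) ltac:(lra)).
    assert (S2 := Hr y w Ky Kw ltac:(lra) ltac:(lra)).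
    assert (S3 := Hr w x Kw Kx ltac:(rewrite Cmod_minus_sym; lra) ltac:(lra)).
    rewrite (Cmod_minus_sym x w) in S3. rewrite <- I2 at 1. lra. }
  assert (H4 : 0 < 4 ^ n) by (apply pow_lt; lra).
  assert (E4 : 4 ^ n = 2 ^ n * 2 ^ n) by (rewrite <- Rpow_mult_distr; f_equal; ring).
  apply Rle_trans with (6 * (p * p) * e).
  - apply Rmult_le_reg_r with (/ 4 ^ n); [ now apply Rinv_0_lt_compat |].
    eapply Rle_trans; [ exact I3 |]. eapply Rle_trans; [ exact Htri |].
    right. unfold P. rewrite E4. specialize (Hp2 n). field. lra.
  - unfold e. assert (0 < 6 * (p * p) + 1) by lra.
    apply Rmult_le_reg_r with (6 * (p * p) + 1); [ assumption |].
    replace (6 * (p * p) * (eps / (6 * (p * p) + 1)) * (6 * (p * p) + 1))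
      with (6 * (p * p) * eps) by (field; lra).
    nra.
Qed.

(** * Primitives *)

Definition interior_point (K : C -> Prop) (z : C) : Prop :=
  exists d, 0 < d /\ forall w, Cmod (w - z) < d -> K w.

Lemma interior_mem (K : C -> Prop) (z : C) : interior_point K z -> K z.
Proof.
  intros [d [Hd H]]. apply H.
  replace (z - z)%C with (RtoC 0) by ring. now rewrite Cmod_0.
Qed.

Lemma seg_additive (K : C -> Prop) (f : C -> C) (a b c : C) :
  convex K -> seq_closed K -> (forall z, K z -> holo f z) ->
  K a -> K b -> K c -> (seg f a c = seg f a b + seg f b c)%C.
Proof.
  intros HK Hcl Hf Ha Hb Hc.
  assert (H := goursat K f a b c HK Hcl Hf Ha Hb Hc).
  rewrite (seg_sym f a c) in H by now apply (holo_seg_cont K).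
  apply Ceq_minus. transitivity (- (seg f a b + seg f b c + - seg f a c))%C; [ ring |].
  rewrite H. ring.
Qed.

Lemma seg_near (f : C -> C) (p q c : C) (m : R) :
  seg_cont f p q ->
  (forall t, 0 <= t <= 1 -> Cmod (f (p + RtoC t * (q - p))%C - c) <= m) ->
  Cmod (seg f p q - c * (q - p)) <= m * Cmod (q - p).
Proof.
  intros Hf Hm. unfold seg.
  replace ((q - p) * mean (fun t => f (p + RtoC t * (q - p))%C) - c * (q - p))%C
    with ((mean (fun t => f (p + RtoC t * (q - p))%C) - c) * (q - p))%C by ring.
  rewrite Cmod_mult. apply Rmult_le_compat_r; [ apply Cmod_ge_0 |].
  apply mean_near; [ now apply seg_cont01 | exact Hm ].
Qed.

Lemma Cmod_on_seg (z p q : C) (t d : R) :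
  0 <= t <= 1 -> Cmod (p - z) < d -> Cmod (q - z) < d ->
  Cmod (p + RtoC t * (q - p) - z) < d.
Proof.
  intros Ht Hp Hq.
  replace (p + RtoC t * (q - p) - z)%C
    with (RtoC (1 - t) * (p - z) + RtoC t * (q - z))%C by (rewrite RtoC_minus; ring).
  eapply Rle_lt_trans; [ apply Cmod_triangle |].
  rewrite !Cmod_mult, !Cmod_R, !Rabs_pos_eq by lra.
  apply Rle_lt_trans with (Rmax (Cmod (p - z)) (Cmod (q - z))); [| now apply Rmax_lub_lt ].
  assert (H1 := Rmax_l (Cmod (p - z)) (Cmod (q - z))).
  assert (H2 := Rmax_r (Cmod (p - z)) (Cmod (q - z))). nra.
Qed.

(** By Goursat's theorem the increment of [seg f z0] from [z] to [w] is the
    integral of [f] over the segment from [z] to [w], hence close to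
    [f z * (w - z)]. *)
Lemma seg_primitive (K : C -> Prop) (f : C -> C) (z0 z : C) :
  convex K -> seq_closed K -> (forall z, K z -> holo f z) ->
  K z0 -> interior_point K z -> cderiv (seg f z0) z (f z).
Proof.
  intros HK Hcl Hf H0 Hint. assert (Hz := interior_mem K z Hint).
  destruct Hint as [d [Hd Hint]].
  apply cderiv_eps. intros e He.
  destruct (proj1 (ccont_eps _ _) (holo_continuous f z (Hf z Hz)) e He)
    as [d' [Hd' Hc]].
  exists (Rmin d d'). split; [ now apply Rmin_glb_lt |].
  intros w Hw.
  assert (Hw1 : Cmod (w - z) < d) by (eapply Rlt_le_trans; [ exact Hw | apply Rmin_l ]).
  assert (Hw2 : Cmod (w - z) < d') by (eapply Rlt_le_trans; [ exact Hw | apply Rmin_r ]).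
  rewrite (seg_additive K f z0 z w) by auto.
  replace (seg f z0 z + seg f z w - seg f z0 z)%C with (seg f z w) by ring.
  apply seg_near.
  - apply (holo_seg_cont K); auto.
  - intros t Ht. apply Rlt_le, Hc. apply Cmod_on_seg; auto.
    replace (z - z)%C with (RtoC 0) by ring. now rewrite Cmod_0.
Qed.

Lemma cderiv_along (f : C -> C) (p v l : C) (t : R) :
  cderiv f (p + RtoC t * v) l ->
  @is_derive R_AbsRing C_R_NormedModule (fun t => f (p + RtoC t * v)%C) t (l * v)%C.
Proof.
  intros H. split; [ apply is_linear_scal_l |].
  intros s Hs. apply (@is_filter_lim_locally_unique R_AbsRing R_NormedModule) in Hs.
  subst s. intros [e He]. simpl.
  assert (Hv : 0 < Cmod v + 1) by (assert (Hv := Cmod_ge_0 v); lra).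
  destruct (proj1 (cderiv_eps _ _ _) H (e / (Cmod v + 1))
    ltac:(now apply Rdiv_lt_0_compat)) as [d [Hd Hw]].
  assert (Hd' : 0 < d / (Cmod v + 1)) by now apply Rdiv_lt_0_compat.
  exists (mkposreal _ Hd'). intros s Hs.
  assert (Hs' : Rabs (s - t) < d / (Cmod v + 1)) by exact Hs. clear Hs.
  rewrite norm_Cmod.
  change (@norm R_AbsRing _ (minus s t)) with (Rabs (s - t)).
  assert (E : (p + RtoC s * v - (p + RtoC t * v) = RtoC (s - t) * v)%C)
    by (rewrite RtoC_minus; ring).
  specialize (Hw (p + RtoC s * v)%C). rewrite E, Cmod_mult, Cmod_R in Hw.
  assert (Ha := Rabs_pos (s - t)). assert (Hm := Cmod_ge_0 v).
  assert (Hlt : Rabs (s - t) * Cmod v < d).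
  { apply Rle_lt_trans with (Rabs (s - t) * (Cmod v + 1)); [ nra |].
    apply Rmult_lt_compat_r with (r := Cmod v + 1) in Hs'; [| exact Hv ].
    replace (d / (Cmod v + 1) * (Cmod v + 1)) with d in Hs' by (field; lra). exact Hs'. }
  specialize (Hw Hlt).
  assert (E2 : @scal R_AbsRing C_R_NormedModule (minus s t) (l * v)%C
     = (l * (RtoC (s - t) * v))%C).
  { rewrite scal_R_Cmult. change (minus s t) with (s - t). ceq. ring. }
  change (Cmod (f (p + RtoC s * v)%C - f (p + RtoC t * v)%C
    - @scal R_AbsRing C_R_NormedModule (minus s t) (l * v)%C)%C <= e * Rabs (s - t)).
  rewrite E2.
  eapply Rle_trans; [ exact Hw |].
  assert (e / (Cmod v + 1) * Cmod v <= e).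
  { apply Rmult_le_reg_r with (1 := Hv).
    replace (e / (Cmod v + 1) * Cmod v * (Cmod v + 1)) with (e * Cmod v) by (field; lra).
    nra. }
  nra.
Qed.

(** The fundamental theorem of calculus along a segment. *)
Lemma seg_derivative (F f : C -> C) (p q : C) :
  seg_cont f p q ->
  (forall t, 0 <= t <= 1 ->
     cderiv F (p + RtoC t * (q - p)) (f (p + RtoC t * (q - p))%C)) ->
  seg f p q = (F q - F p)%C.
Proof.
  intros Hc Hd. unfold seg. rewrite Cmult_comm.
  assert (H := @is_RInt_derive C_R_CompleteNormedModule
    (fun t => F (p + RtoC t * (q - p))%C)
    (fun t => f (p + RtoC t * (q - p))%C * (q - p))%C 0 1).
  rewrite Rmin_left, Rmax_right in H by lra.
  specialize (H (fun t Ht => cderiv_along F p (q - p) _ t (Hd t Ht))).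
  assert (Hcc : forall t, 0 <= t <= 1 ->
    pcont (fun t => f (p + RtoC t * (q - p))%C * (q - p))%C t).
  { intros t Ht. apply continuous_Cmult; [ now apply seg_cont01 | apply continuous_const ]. }
  specialize (H Hcc). apply mean_unique in H.
  rewrite (mean_ext _ (fun t => (q - p) * f (p + RtoC t * (q - p))%C)%C) in H
    by (intros; ring).
  rewrite mean_scal in H by now apply seg_cont01.
  rewrite Cmult_comm. rewrite H.
  replace (p + RtoC 1 * (q - p))%C with q by ring.
  now replace (p + RtoC 0 * (q - p))%C with p by ring.
Qed.

Lemma cderiv_zero_const (F : C -> C) (p q : C) :
  (forall t, 0 <= t <= 1 -> cderiv F (p + RtoC t * (q - p)) 0) -> F p = F q.
Proof.
  intros H.
  assert (E := seg_derivative F (fun _ => RtoC 0) p q). cbv beta in E.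
  specialize (E (fun t _ => continuous_const _ _) H).
  unfold seg in E. rewrite mean_const, Cmult_0_r in E.
  symmetry. now apply Ceq_minus.
Qed.

(** The increment [f x - f y] is the integral of [f1] over a segment on which
    [f1] is close to [f1 p]. *)
Lemma strictly_differentiable (f f1 : C -> C) (p : C) (R0 : R) :
  0 < R0 ->
  (forall w, Cmod (w - p) < R0 -> cderiv f w (f1 w) /\ ccont f1 w) ->
  forall e, 0 < e -> exists d, 0 < d /\ forall x y,
    Cmod (x - p) < d -> Cmod (y - p) < d ->
    Cmod (f x - f y - f1 p * (x - y)) <= e * Cmod (x - y).
Proof.
  intros HR H e He.
  assert (Hp : Cmod (p - p) = 0)
    by (replace (p - p)%C with (RtoC 0) by ring; apply Cmod_0).
  destruct (proj1 (ccont_eps _ _) (proj2 (H p ltac:(lra))) e He) as [d [Hd Hc]].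
  exists (Rmin d R0). split; [ now apply Rmin_glb_lt |]. intros x y Hx Hy.
  assert (Hseg : forall t, 0 <= t <= 1 -> Cmod (y + RtoC t * (x - y) - p) < Rmin d R0)
    by (intros; now apply Cmod_on_seg).
  assert (Hsc : seg_cont f1 y x).
  { intros t Ht. apply H. eapply Rlt_le_trans; [ now apply Hseg | apply Rmin_r ]. }
  rewrite <- (seg_derivative f f1 y x); [| exact Hsc |].
  - apply seg_near; [ exact Hsc |]. intros t Ht. apply Rlt_le, Hc.
    eapply Rlt_le_trans; [ now apply Hseg | apply Rmin_l ].
  - intros t Ht. apply H. eapply Rlt_le_trans; [ now apply Hseg | apply Rmin_r ].
Qed.

(** * Compactness of intervals and paths *)

(** Cousin's compactness principle: a relation between the ends of intervals
    which is transitive, and holds for all small intervals around each point,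
    holds for the whole interval. The supremum of the right ends reached from
    [a] cannot lie before [b]. *)
Lemma cousin (P : R -> R -> Prop) (a b : R) :
  a <= b ->
  (forall u v w, a <= u -> u <= v -> v <= w -> w <= b -> P u v -> P v w -> P u w) ->
  (forall t, a <= t <= b -> exists d, 0 < d /\ forall u v,
     a <= u -> u <= t -> t <= v -> v <= b -> t - d < u -> v < t + d -> P u v) ->
  P a b.
Proof.
  intros Hab Htr Hloc.
  set (E := fun x => a <= x <= b /\ P a x).
  assert (Ha : E a).
  { split; [ lra |]. destruct (Hloc a ltac:(lra)) as [d [Hd H]]. apply H; lra. }
  destruct (completeness E) as [s [Hub Hlub]].
  - exists b. intros x [Hx _]. lra.
  - now exists a.
  - assert (Hs : a <= s <= b).
    { split; [ now apply Hub | apply Hlub; intros x [Hx _]; lra ]. }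
    destruct (Hloc s Hs) as [d [Hd H]].
    assert (Hx : exists x, E x /\ s - d < x).
    { apply NNPP. intros Hn.
      assert (s <= s - d); [| lra ].
      apply Hlub. intros x Hx. apply Rnot_lt_le. intros Hlt. apply Hn. now exists x. }
    destruct Hx as [x [[Hx1 Hx2] Hx3]].
    assert (Hxs : x <= s) by (apply Hub; now split).
    assert (Hgo : forall y, s <= y -> y <= b -> y < s + d -> E y).
    { intros y H1 H2 H3. split; [ lra |].
      apply (Htr a x y); auto; try lra. apply H; lra. }
    destruct (Req_dec s b) as [-> | Hne].
    + apply Hgo; lra.
    + exfalso. set (y := Rmin b (s + d / 2)).
      assert (Hy1 : y <= b) by apply Rmin_l.
      assert (Hy2 : y <= s + d / 2) by apply Rmin_r.
      assert (Hy3 : s < y) by (apply Rmin_glb_lt; lra).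
      assert (y <= s) by (apply Hub, Hgo; lra). lra.
Qed.

Lemma pcont_eps (c : R -> C) (t : R) :
  pcont c t -> forall e, 0 < e -> exists d, 0 < d /\
    forall s, Rabs (s - t) < d -> Cmod (c s - c t) < e.
Proof.
  intros H e He. destruct (proj1 (continuous_Cmod c t) H e He) as [d Hd].
  exists d. split; [ apply cond_pos |]. intros s Hs. now apply Hd.
Qed.

(** A property of pairs [(w, k)] true for [w] near the path and [k] small holds
    on the path with one bound on [k]; it yields uniform continuity, uniform
    differentiability and tubular neighbourhoods. *)
Lemma uniform_on_path (c : R -> C) (Q : C -> C -> Prop) (a b : R) :
  a <= b -> (forall t, a <= t <= b -> pcont c t) ->
  (forall t, a <= t <= b -> exists r, 0 < r /\ forall w k,
     Cmod (w - c t) < r -> Cmod k < r -> Q w k) ->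
  exists d, 0 < d /\ forall t k, a <= t <= b -> Cmod k < d -> Q (c t) k.
Proof.
  intros Hab Hc HQ.
  apply (cousin (fun u v => exists d, 0 < d /\
    forall t k, u <= t <= v -> Cmod k < d -> Q (c t) k)); [ exact Hab | |].
  - intros u v w _ _ _ _ [d1 [Hd1 H1]] [d2 [Hd2 H2]].
    exists (Rmin d1 d2). split; [ now apply Rmin_glb_lt |].
    intros t k Ht Hk. destruct (Rle_dec t v).
    + apply H1; [ lra | eapply Rlt_le_trans; [ exact Hk | apply Rmin_l ] ].
    + apply H2; [ lra | eapply Rlt_le_trans; [ exact Hk | apply Rmin_r ] ].
  - intros t Ht. destruct (HQ t Ht) as [r [Hr H]].
    destruct (pcont_eps c t (Hc t Ht) r Hr) as [d [Hd Hd']].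
    exists d. split; [ exact Hd |]. intros u v Hu1 Hu2 Hv1 Hv2 Hu3 Hv3.
    exists r. split; [ exact Hr |]. intros s k Hs Hk. apply H; [| exact Hk ].
    apply Hd'. apply Rabs_def1; lra.
Qed.

(** * The complex exponential *)

Definition Cexp (z : C) : C := (exp (Re z) * cos (Im z), exp (Re z) * sin (Im z)).

Lemma Cexp_plus (z w : C) : Cexp (z + w) = (Cexp z * Cexp w)%C.
Proof.
  destruct z as [x y], w as [u v]. unfold Cexp, Cmult, Re, Im; simpl.
  rewrite exp_plus, cos_plus, sin_plus. f_equal; ring.
Qed.

Lemma Cexp_RtoC (x : R) : Cexp (RtoC x) = RtoC (exp x).
Proof. unfold Cexp, Re, Im, RtoC; simpl. rewrite cos_0, sin_0. f_equal; ring. Qed.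

Lemma Cmod_Cexp (z : C) : Cmod (Cexp z) = exp (Re z).
Proof.
  assert (H := sin2_cos2 (Im z)). unfold Rsqr in H.
  unfold Cmod, Cexp. simpl fst. simpl snd.
  replace ((exp (Re z) * cos (Im z)) ^ 2 + (exp (Re z) * sin (Im z)) ^ 2)
    with (exp (Re z) * exp (Re z) * (sin (Im z) * sin (Im z) + cos (Im z) * cos (Im z)))
    by ring.
  rewrite H, Rmult_1_r. apply sqrt_square, Rlt_le, exp_pos.
Qed.

Lemma Cexp_neq_0 (z : C) : Cexp z <> 0.
Proof. apply Cmod_gt_0. rewrite Cmod_Cexp. apply exp_pos. Qed.

Lemma is_derive_eps (f : R -> R) (x l : R) :
  is_derive f x l -> forall e, 0 < e -> exists d, 0 < d /\
    forall h, Rabs h < d -> Rabs (f (x + h) - f x - l * h) <= e * Rabs h.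
Proof.
  intros [_ H] e He. specialize (H x (fun P HP => HP) (mkposreal e He)).
  destruct H as [d Hd]. exists d. split; [ apply cond_pos |]. intros h Hh.
  assert (Hb : @ball R_UniformSpace x d (x + h)).
  { change (Rabs (x + h - x) < d). now replace (x + h - x) with h by ring. }
  specialize (Hd _ Hb).
  change (Rabs (f (x + h) - f x - (x + h - x) * l) <= e * Rabs (x + h - x)) in Hd.
  replace (x + h - x) with h in Hd by ring. now rewrite (Rmult_comm l).
Qed.

(** With [w = x + i y], the remainder is split as
    [(exp x - 1 - x) e^(iy) + x (e^(iy) - 1) + (e^(iy) - 1 - i y)], each term
    being small compared with [|w|]. *)
Lemma cderiv_Cexp_0 : cderiv Cexp 0 1.
Proof.
  (* The real and imaginary parts of the remainder are each at most three
     times [e' * Cmod w], and [Cmod_pair_le] costs a factor 2. *)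
  apply cderiv_eps. intros e He. set (e' := e / 6).
  assert (He' : 0 < e') by (unfold e'; lra).
  assert (X1 := is_derive_exp 0). rewrite exp_0 in X1.
  assert (X2 := is_derive_cos 0). rewrite sin_0, Ropp_0 in X2.
  assert (X3 := is_derive_sin 0). rewrite cos_0 in X3.
  destruct (is_derive_eps exp 0 1 X1 e' He') as [d1 [Hd1 H1]].
  destruct (is_derive_eps cos 0 0 X2 e' He') as [d2 [Hd2 H2]].
  destruct (is_derive_eps sin 0 1 X3 e' He') as [d3 [Hd3 H3]].
  assert (Hd4 : 0 < e' / (1 + e')) by (apply Rdiv_lt_0_compat; lra).
  exists (Rmin (Rmin d1 d2) (Rmin d3 (e' / (1 + e')))).
  split; [ repeat apply Rmin_glb_lt; assumption |].
  intros w Hw. replace (w - 0)%C with w in * by ring.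
  assert (Hw1 : Cmod w < d1) by
    (eapply Rlt_le_trans; [ exact Hw | eapply Rle_trans; [ apply Rmin_l | apply Rmin_l ] ]).
  assert (Hw2 : Cmod w < d2) by
    (eapply Rlt_le_trans; [ exact Hw | eapply Rle_trans; [ apply Rmin_l | apply Rmin_r ] ]).
  assert (Hw3 : Cmod w < d3) by
    (eapply Rlt_le_trans; [ exact Hw | eapply Rle_trans; [ apply Rmin_r | apply Rmin_l ] ]).
  assert (Hw4 : Cmod w < e' / (1 + e')) by
    (eapply Rlt_le_trans; [ exact Hw | eapply Rle_trans; [ apply Rmin_r | apply Rmin_r ] ]).
  clear Hw. set (A := Cmod w) in *.
  assert (HA : 0 <= A) by apply Cmod_ge_0.
  apply Rmult_lt_compat_r with (r := 1 + e') in Hw4; [| lra ].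
  replace (e' / (1 + e') * (1 + e')) with e' in Hw4 by (field; lra).
  assert (HA1 : A <= 1) by nra.
  assert (Hx := Cmod_fst w). assert (Hy := Cmod_snd w). fold A in Hx, Hy.
  specialize (H1 (fst w) ltac:(lra)). specialize (H2 (snd w) ltac:(lra)).
  specialize (H3 (snd w) ltac:(lra)).
  rewrite Rplus_0_l in H1, H2, H3. rewrite exp_0 in H1. rewrite cos_0 in H2.
  rewrite sin_0 in H3. rewrite Rmult_0_l in H2. rewrite Rmult_1_l in H1, H3.
  replace (e * A) with (2 * (3 * e' * A)) by (unfold e'; field).
  rewrite Cexp_RtoC, exp_0. replace (1 * w)%C with w by ring.
  assert (Hc : Rabs (cos (snd w)) <= 1) by (apply Rabs_le, COS_bound).
  assert (Hs : Rabs (sin (snd w)) <= 1) by (apply Rabs_le, SIN_bound).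
  assert (P : forall u v U V, Rabs u <= U -> Rabs v <= V -> Rabs (u * v) <= U * V).
  { intros u v U V Hu Hv. rewrite Rabs_mult.
    apply Rmult_le_compat; auto using Rabs_pos. }
  assert (B1 : Rabs (exp (fst w) - 1 - fst w) <= e' * A) by nra.
  assert (B2 : Rabs (cos (snd w) - 1 - 0) <= e' * A) by nra.
  assert (B3 : Rabs (sin (snd w) - 0 - snd w) <= e' * A) by nra.
  assert (B4 : Rabs (sin (snd w)) <= (1 + e') * A).
  { replace (sin (snd w)) with ((sin (snd w) - 0 - snd w) + snd w) by ring.
    eapply Rle_trans; [ apply Rabs_triang |]. lra. }
  apply Cmod_pair_le; unfold Cexp, Re, Im; simpl.
  - replace (exp (fst w) * cos (snd w) + - (1) + - fst w)
      with ((exp (fst w) - 1 - fst w) * cos (snd w)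
            + (fst w * (cos (snd w) - 1 - 0) + (cos (snd w) - 1 - 0))) by ring.
    eapply Rle_trans; [ apply Rabs_triang |].
    assert (T := Rabs_triang (fst w * (cos (snd w) - 1 - 0)) (cos (snd w) - 1 - 0)).
    assert (Q1 := P _ _ _ _ B1 Hc). assert (Q2 := P _ _ _ _ Hx B2).
    assert (A * (e' * A) <= e' * A) by nra. lra.
  - replace (exp (fst w) * sin (snd w) + - 0 + - snd w)
      with ((exp (fst w) - 1 - fst w) * sin (snd w)
            + (fst w * sin (snd w) + (sin (snd w) - 0 - snd w))) by ring.
    eapply Rle_trans; [ apply Rabs_triang |].
    assert (T := Rabs_triang (fst w * sin (snd w)) (sin (snd w) - 0 - snd w)).
    assert (Q1 := P _ _ _ _ B1 Hs). assert (Q2 := P _ _ _ _ Hx B4).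
    assert (A * ((1 + e') * A) <= e' * A) by nra. lra.
Qed.

Lemma cderiv_Cexp (z : C) : cderiv Cexp z (Cexp z).
Proof.
  apply cderiv_ext with (f := fun w => (Cexp z * Cexp (w + - z))%C).
  - intros w. rewrite <- Cexp_plus. f_equal. ring.
  - assert (H : cderiv Cexp (z + - z) 1).
    { replace (z + - z)%C with (RtoC 0) by ring. exact cderiv_Cexp_0. }
    apply cderiv_shift, (cderiv_scal (Cexp z)) in H. now rewrite Cmult_1_r in H.
Qed.

(** * Cauchy's formulas at the centre of a circle *)

(** [e ^ (2 pi i t)], so that the unit circle is run through once as [t] goes
    from 0 to 1. Its conjugate is its inverse. *)
Definition cis (t : R) : C := Cexp (RtoC t * (2 * PI * Ci)).

Lemma cis_alt (t : R) : cis t = (cos (2 * PI * t), sin (2 * PI * t)).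
Proof.
  unfold cis, Cexp, Re, Im; simpl.
  match goal with |- (exp ?u * cos ?v, _) = _ =>
    replace u with 0 by ring; replace v with (2 * PI * t) by ring end.
  rewrite exp_0. f_equal; ring.
Qed.

Lemma Cmod_cis (t : R) : Cmod (cis t) = 1.
Proof.
  unfold cis. rewrite Cmod_Cexp. rewrite <- exp_0. f_equal. unfold Re; simpl. ring.
Qed.

Lemma cis_conj (t : R) : (cis t * Cconj (cis t))%C = 1.
Proof. rewrite <- Cmod2_conj, Cmod_cis. f_equal. ring. Qed.

Lemma continuous_cis (t : R) : pcont cis t.
Proof.
  apply (continuous_comp (fun t : R => (RtoC t * (2 * PI * Ci))%C) Cexp).
  - apply continuous_Cmult; [| apply continuous_const ].
    apply (continuous_RtoC (fun t : R => t)), continuous_id.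
  - apply (cderiv_continuous _ _ _ (cderiv_Cexp _)).
Qed.

Lemma Cexp_opp (z : C) : Cexp (- z) = (/ Cexp z)%C.
Proof.
  assert (H : (Cexp z * Cexp (- z) = 1)%C).
  { rewrite <- Cexp_plus. replace (z + - z)%C with (RtoC 0) by ring.
    now rewrite Cexp_RtoC, exp_0. }
  assert (H0 := Cexp_neq_0 z).
  replace (Cexp (- z)) with (/ Cexp z * (Cexp z * Cexp (- z)))%C by (field; exact H0).
  rewrite H. ring.
Qed.

Lemma cis_inv (t : R) : (/ cis t)%C = Cconj (cis t).
Proof.
  assert (H := cis_conj t). assert (H0 : cis t <> 0) by apply Cexp_neq_0.
  replace (Cconj (cis t)) with (/ cis t * (cis t * Cconj (cis t)))%C by (field; exact H0).
  rewrite H. ring.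
Qed.

Definition circle (z : C) (r t : R) : C := (z + RtoC r * cis t)%C.

Lemma Cmod_circle (z : C) (r t : R) : 0 < r -> Cmod (circle z r t - z) = r.
Proof.
  intros Hr. unfold circle. replace (z + RtoC r * cis t - z)%C with (RtoC r * cis t)%C by ring.
  rewrite Cmod_mult, Cmod_cis, Cmod_R, Rabs_pos_eq; lra.
Qed.

Lemma continuous_circle (z : C) (r t : R) : pcont (circle z r) t.
Proof.
  apply continuous_Cplus; [ apply continuous_const |].
  apply continuous_Cmult; [ apply continuous_const | apply continuous_cis ].
Qed.

Lemma circle_cont01 (f : C -> C) (z : C) (r : R) :
  (forall t, 0 <= t <= 1 -> ccont f (circle z r t)) ->
  cont01 (fun t => f (circle z r t)).
Proof.
  intros Hf t Ht. apply (continuous_comp (circle z r) f);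
    [ apply continuous_circle | now apply Hf ].
Qed.

Lemma cis_conj_cont01 (g : R -> C) :
  cont01 g -> cont01 (fun t => g t * Cconj (cis t))%C.
Proof.
  intros Hg t Ht. apply continuous_Cmult; [ now apply Hg |].
  apply continuous_Cconj, continuous_cis.
Qed.

Lemma half_plane_convex (X : R) : convex (fun z => Re z <= X).
Proof.
  intros p q t Hp Hq Ht. unfold Re in *; simpl. nra.
Qed.

Lemma half_plane_closed (X : R) : seq_closed (fun z => Re z <= X).
Proof.
  intros z H. apply le_epsilon. intros e He. destruct (H e He) as [w [Hw Hd]].
  assert (H1 := Cmod_fst (w - z)%C). apply Rabs_le_between in H1.
  unfold Re in *. simpl in H1. lra.
Qed.

(** In the coordinate [u = ln (w - z)] the integrand becomes the holomorphic
    function [(f (z + e^u) - f z) e^(-u)] on a half-plane, with period [2 pi i].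
    Its integral around a rectangle of height [2 pi] vanishes by Goursat's
    theorem, the two horizontal sides cancel by periodicity, and the vertical
    sides are the means over the two circles. *)
Lemma mean_circle_invariant (f : C -> C) (z : C) (r0 r1 : R) :
  0 < r0 -> r0 <= r1 -> (forall w, Cmod (w - z) <= r1 -> holo f w) ->
  (mean (fun t => (f (circle z r0 t) - f z) * Cconj (cis t)) / r0 =
   mean (fun t => (f (circle z r1 t) - f z) * Cconj (cis t)) / r1)%C.
Proof.
  intros H0 H01 Hf.
  set (H := fun u => ((f (z + Cexp u) - f z) * Cexp (- u))%C).
  (* The inverse image of the disc of radius [r1] under [u -> z + Cexp u]. *)
  set (K := fun u => Re u <= ln r1).
  assert (HK := half_plane_convex (ln r1)). assert (HKc := half_plane_closed (ln r1)).
  fold K in HK, HKc.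
  assert (HH : forall u, K u -> holo H u).
  { intros u Hu. destruct (Hf (z + Cexp u)%C) as [l Hl].
    - replace (z + Cexp u - z)%C with (Cexp u) by ring. rewrite Cmod_Cexp.
      rewrite <- (exp_ln r1) by lra. destruct Hu as [Hu | Hu].
      + now apply Rlt_le, exp_increasing.
      + rewrite Hu. lra.
    - eexists. unfold H. apply cderiv_mult.
      + apply cderiv_minus; [| apply cderiv_const ].
        apply (cderiv_comp f (fun u => z + Cexp u)%C); [ exact Hl |].
        apply cderiv_plus; [ apply cderiv_const | apply cderiv_Cexp ].
      + apply (cderiv_comp Cexp (fun u => - u)%C); [ apply cderiv_Cexp |].
        apply cderiv_ext with (f := fun u => (-1 * u)%C); [ intros; ring |].
        apply cderiv_scal, cderiv_id. }
  set (T := (2 * PI * Ci)%C).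
  assert (HT : forall u, H (u + T)%C = H u).
  { assert (E : Cexp T = 1).
    { change T with (2 * PI * Ci)%C. replace (2 * PI * Ci)%C with (RtoC 1 * (2 * PI * Ci))%C by ring.
      fold (cis 1). rewrite cis_alt, Rmult_1_r, cos_2PI, sin_2PI. reflexivity. }
    intros u. unfold H. rewrite Copp_plus_distr, !Cexp_plus, (Cexp_opp T), E, Cmult_1_r. field. }
  assert (Hc : forall r, 0 < r -> r <= r1 ->
    cont01 (fun t => (f (circle z r t) - f z) * Cconj (cis t))%C).
  { intros r Hr Hr1. apply cis_conj_cont01. intros t Ht.
    apply continuous_Cminus; [| apply continuous_const ].
    apply (circle_cont01 f z r); [| exact Ht ].
    intros s Hs. apply holo_continuous, Hf. now rewrite Cmod_circle. }
  assert (HSeg : forall r, 0 < r -> r <= r1 ->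
    (seg H (ln r) (ln r + T) =
     T * (mean (fun t => (f (circle z r t) - f z) * Cconj (cis t)) / r))%C).
  { intros r Hr Hr1. unfold seg.
    replace (RtoC (ln r) + T - RtoC (ln r))%C with T by ring. f_equal.
    unfold Cdiv. rewrite Cmult_comm, <- mean_scal by now apply Hc.
    apply mean_ext. intros t _.
    assert (E : Cexp (RtoC (ln r) + RtoC t * T) = (RtoC r * cis t)%C).
    { rewrite Cexp_plus, Cexp_RtoC, exp_ln by exact Hr. reflexivity. }
    unfold H. rewrite Cexp_opp, E, <- cis_inv. unfold circle. field.
    split; [ apply Cexp_neq_0 | intros E0; apply RtoC_inj in E0; lra ]. }
  assert (HTn : T <> 0).
  { apply Cmult_neq_0; [ apply Cmult_neq_0 | apply Ci_nz ];
      intros E0; apply RtoC_inj in E0; [ lra |]. assert (P := PI_RGT_0). lra. }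
  assert (Kx : forall r, 0 < r -> r <= r1 -> K (RtoC (ln r)) /\ K (RtoC (ln r) + T)%C).
  { intros r Hr [Hr1 | ->]; unfold K, Re; simpl; split; try lra.
    - now apply Rlt_le, ln_increasing.
    - assert (ln r < ln r1) by now apply ln_increasing. lra. }
  destruct (Kx r0 H0 H01) as [K1 K2], (Kx r1 ltac:(lra) ltac:(lra)) as [K3 K4].
  assert (A1 := seg_additive K H _ _ _ HK HKc HH K1 K3 K4).
  assert (A2 := seg_additive K H _ _ _ HK HKc HH K1 K2 K4).
  assert (A3 : seg H (ln r0 + T) (ln r1 + T) = seg H (ln r0) (ln r1)).
  { unfold seg.
    replace (RtoC (ln r1) + T - (RtoC (ln r0) + T))%C
      with (RtoC (ln r1) - RtoC (ln r0))%C by ring.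
    f_equal. apply mean_ext. intros t _. rewrite <- (HT (RtoC (ln r0) + _)%C).
    f_equal. ring. }
  rewrite A1, A3, !HSeg in A2 by lra.
  set (m0 := (mean _ / r0)%C) in *. set (m1 := (mean _ / r1)%C) in *.
  assert (E : (T * m1 = T * m0)%C).
  { transitivity (seg H (ln r0) (ln r1) + T * m1 - seg H (ln r0) (ln r1))%C; [ ring |].
    rewrite A2. ring. }
  replace m0 with (/ T * (T * m0))%C by (field; exact HTn).
  rewrite <- E. field. exact HTn.
Qed.

(** Cauchy's formula for the derivative at the centre. The left-hand side divided
    by [r] does not depend on [r], and tends to [l] as [r] tends to 0. *)
Lemma cauchy_derivative (f : C -> C) (z l : C) (r : R) :
  0 < r -> (forall w, Cmod (w - z) <= r -> holo f w) -> cderiv f z l ->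
  (mean (fun t => (f (circle z r t) - f z) * Cconj (cis t)) = r * l)%C.
Proof.
  intros Hr Hf Hl.
  assert (Hrn : forall x, 0 < x -> RtoC x <> 0)
    by (intros x Hx E0; apply RtoC_inj in E0; lra).
  set (m := fun r => mean (fun t => (f (circle z r t) - f z) * Cconj (cis t))%C).
  change (m r = (r * l)%C).
  assert (E : (m r / r - l = 0)%C).
  2:{ replace (m r) with (r * (m r / r - l) + r * l)%C by (field; now apply Hrn).
      rewrite E. ring. }
  apply Cmod_eq_0, Rle_antisym; [| apply Cmod_ge_0 ].
  apply le_epsilon. intros e He. rewrite Rplus_0_l.
  destruct (proj1 (cderiv_eps _ _ _) Hl e He) as [d [Hd H]].
  set (x := Rmin r (d / 2)).
  assert (Hx : 0 < x) by (apply Rmin_glb_lt; lra).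
  assert (Hxr : x <= r) by apply Rmin_l.
  assert (Hxd : x < d) by (assert (x <= d / 2) by apply Rmin_r; lra).
  (* From here on the radius is [x], small enough for the estimate [H]. *)
  unfold m. rewrite <- (mean_circle_invariant f z x r) by auto.
  assert (Hc : cont01 (fun t => (f (circle z x t) - f z) * Cconj (cis t))%C).
  { apply cis_conj_cont01. intros t Ht.
    apply continuous_Cminus; [| apply continuous_const ].
    apply (circle_cont01 f z x); [| exact Ht ].
    intros s Hs. apply holo_continuous, Hf. now rewrite Cmod_circle. }
  unfold Cdiv. rewrite Cmult_comm, <- mean_scal by exact Hc.
  apply mean_near.
  - intros t Ht. apply continuous_Cmult; [ apply continuous_const | now apply Hc ].
  - intros t _.
    assert (Hw : Cmod (circle z x t - z) < d) by now rewrite Cmod_circle.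
    specialize (H _ Hw). rewrite Cmod_circle in H by exact Hx.
    assert (E : (/ x * ((f (circle z x t) - f z) * Cconj (cis t)) - l =
      / x * ((f (circle z x t) - f z - l * (circle z x t - z)) * Cconj (cis t)))%C).
    { replace (circle z x t - z)%C with (RtoC x * cis t)%C by (unfold circle; ring).
      replace ((f (circle z x t) - f z - l * (RtoC x * cis t)) * Cconj (cis t))%C
        with ((f (circle z x t) - f z) * Cconj (cis t) - l * x * (cis t * Cconj (cis t)))%C
        by ring.
      rewrite cis_conj. field. now apply Hrn. }
    rewrite E, !Cmod_mult, Cmod_conj, Cmod_cis, Rmult_1_r.
    rewrite Cmod_inv, Cmod_R, Rabs_pos_eq by (auto; lra).
    apply Rmult_le_reg_l with x; [ exact Hx |].
    rewrite <- Rmult_assoc, Rinv_r, Rmult_1_l by lra. lra.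
Qed.

(** Cauchy's formula for [(u - z) * f u], whose derivative at [z] is [f z]. *)
Lemma mean_value (f : C -> C) (z : C) (r : R) :
  0 < r -> (forall w, Cmod (w - z) <= r -> holo f w) ->
  mean (fun t => f (circle z r t)) = f z.
Proof.
  intros Hr Hf.
  assert (Hrn : RtoC r <> 0) by (intros E0; apply RtoC_inj in E0; lra).
  destruct (Hf z) as [l Hl].
  { replace (z - z)%C with (RtoC 0) by ring. rewrite Cmod_0. lra. }
  assert (D : forall w l, cderiv f w l ->
    cderiv (fun u => (u - z) * f u)%C w ((1 - 0) * f w + (w - z) * l)).
  { intros w k Hk. apply (cderiv_mult (fun u => u - z)%C f); [| exact Hk ].
    apply cderiv_minus; [ apply cderiv_id | apply cderiv_const ]. }
  assert (H := cauchy_derivative (fun u => (u - z) * f u)%C z _ r Hr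
    ltac:(intros w Hw; destruct (Hf w Hw) as [k Hk]; eexists; apply D, Hk) (D z l Hl)).
  cbv beta in H.
  rewrite (mean_ext _ (fun t => r * f (circle z r t))%C) in H.
  - rewrite mean_scal in H.
    + replace (mean (fun t => f (circle z r t)))
        with (/ r * (r * mean (fun t => f (circle z r t))))%C by (field; exact Hrn).
      rewrite H. field. exact Hrn.
    + apply circle_cont01. intros t _. apply holo_continuous, Hf.
      now rewrite Cmod_circle; [ right |].
  - intros t _.
    transitivity (r * f (circle z r t) * (cis t * Cconj (cis t)))%C.
    + unfold circle. ring.
    + rewrite cis_conj. ring.
Qed.

(** The mean value property of [(u - z) * (f u - f z)], which vanishes at [z]. *)
Lemma mean_circle_moment (f : C -> C) (z : C) (r : R) :
  0 < r -> (forall w, Cmod (w - z) <= r -> holo f w) ->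
  mean (fun t => (f (circle z r t) - f z) * cis t)%C = 0.
Proof.
  intros Hr Hf.
  assert (Hrn : RtoC r <> 0) by (intros E0; apply RtoC_inj in E0; lra).
  set (g := fun u => ((u - z) * (f u - f z))%C).
  assert (D : forall w, Cmod (w - z) <= r -> holo g w).
  { intros w Hw. destruct (Hf w Hw) as [k Hk]. eexists.
    apply (cderiv_mult (fun u => u - z)%C (fun u => f u - f z)%C).
    - apply cderiv_minus; [ apply cderiv_id | apply cderiv_const ].
    - apply cderiv_minus; [ exact Hk | apply cderiv_const ]. }
  assert (H := mean_value g z r Hr D).
  rewrite (mean_ext _ (fun t => r * ((f (circle z r t) - f z) * cis t))%C) in H.
  - rewrite mean_scal in H.
    + replace (mean (fun t => (f (circle z r t) - f z) * cis t)%C)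
        with (/ r * (r * mean (fun t => (f (circle z r t) - f z) * cis t)))%C
        by (field; exact Hrn).
      rewrite H. unfold g. ring.
    + intros t Ht. apply continuous_Cmult; [| apply continuous_cis ].
      apply continuous_Cminus; [| apply continuous_const ].
      apply (circle_cont01 f z r); [| exact Ht ]. intros s _.
      apply holo_continuous, Hf. now rewrite Cmod_circle; [ right |].
  - intros t _. unfold g. replace (circle z r t - z)%C with (r * cis t)%C by (unfold circle; ring).
    ring.
Qed.

(** * Regularity of the derivative *)

Lemma holo_C_derive (f : C -> C) (z : C) : holo f z -> cderiv f z (C_derive f z).
Proof.
  intros [l H]. assert (H' := proj2 (is_derive_cderiv _ _ _) H).
  now rewrite (is_C_derive_unique _ _ _ H').
Qed.

Lemma RtoC_neq_0 (x : R) : x <> 0 -> RtoC x <> 0.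
Proof. intros H E. now apply RtoC_inj in E. Qed.

Lemma circle_shift (z k : C) (r t : R) : circle (z + k) r t = (circle z r t + k)%C.
Proof. unfold circle. ring. Qed.

Lemma Cmod_self (z : C) : Cmod (z - z) = 0.
Proof. replace (z - z)%C with (RtoC 0) by ring. apply Cmod_0. Qed.

Lemma Cmod_between (x y z : C) : Cmod (x - z) <= Cmod (x - y) + Cmod (y - z).
Proof.
  replace (x - z)%C with ((x - y) + (y - z))%C by ring. apply Cmod_triangle.
Qed.

Lemma Cmod_add_sub (z k : C) : Cmod (z + k - z) = Cmod k.
Proof. f_equal. ring. Qed.

(** Cauchy's formula at a moving centre, written over the fixed circle around
    [z0] so that it can be compared for different [k]. *)
Lemma cauchy_derivative_shifted (f f1 : C -> C) (z0 k : C) (r : R) :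
  0 < r -> (forall w, Cmod (w - z0) < 3 * r -> cderiv f w (f1 w)) -> Cmod k < r ->
  cont01 (fun t => (f (circle z0 r t + k)%C - f (z0 + k)%C) * Cconj (cis t))%C /\
  (mean (fun t => (f (circle z0 r t + k)%C - f (z0 + k)%C) * Cconj (cis t))
    = r * f1 (z0 + k)%C)%C.
Proof.
  intros Hr Hf Hk.
  assert (Hin : forall w, Cmod (w - (z0 + k)) <= r -> cderiv f w (f1 w)).
  { intros w Hw. apply Hf.
    assert (T := Cmod_between w (z0 + k) z0). rewrite Cmod_add_sub in T. lra. }
  split.
  - apply cis_conj_cont01. intros t Ht.
    apply continuous_Cminus; [| apply continuous_const ].
    apply continuous_ext with (f := fun t => f (circle (z0 + k) r t)).
    + intros s. now rewrite circle_shift.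
    + apply (circle_cont01 f (z0 + k) r); [| exact Ht ].
      intros s _. eapply cderiv_continuous, Hin.
      rewrite Cmod_circle; lra.
  - rewrite <- (cauchy_derivative f (z0 + k) (f1 (z0 + k)%C) r Hr).
    + apply mean_ext. intros t _. now rewrite circle_shift.
    + intros w Hw. eexists. now apply Hin.
    + apply Hin. rewrite Cmod_self. lra.
Qed.

Lemma mean_conj_cis_le (g : R -> C) (m : R) :
  cont01 (fun t => g t * Cconj (cis t))%C ->
  (forall t, 0 <= t <= 1 -> Cmod (g t) <= m) ->
  Cmod (mean (fun t => g t * Cconj (cis t))%C) <= m.
Proof.
  intros Hc Hm. apply mean_le_const; [ exact Hc |]. intros t Ht.
  rewrite Cmod_mult, Cmod_conj, Cmod_cis, Rmult_1_r. now apply Hm.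
Qed.

(** Cauchy's formula expresses [f1] by means of [f] over a circle, and [f] is
    uniformly continuous near that circle. *)
Lemma derivative_continuous (f f1 : C -> C) (z0 : C) (d : R) :
  0 < d -> (forall w, Cmod (w - z0) < d -> cderiv f w (f1 w)) -> ccont f1 z0.
Proof.
  intros Hd Hf. set (r := d / 3). assert (Hr : 0 < r) by (unfold r; lra).
  assert (Hf' : forall w, Cmod (w - z0) < 3 * r -> cderiv f w (f1 w))
    by (intros w Hw; apply Hf; unfold r in Hw; lra).
  assert (Hn := RtoC_neq_0 r ltac:(lra)).
  apply ccont_eps. intros e He. set (e' := r * e / 4).
  assert (He' : 0 < e') by (unfold e'; nra).
  assert (Hc : forall w, Cmod (w - z0) < d -> ccont f w)
    by (intros w Hw; eapply cderiv_continuous; now apply Hf).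
  destruct (uniform_on_path (circle z0 r) (fun w k => Cmod (f (w + k)%C - f w) <= e') 0 1)
    as [d1 [Hd1 H1]]; [ lra | intros; apply continuous_circle | |].
  { intros t _.
    destruct (proj1 (ccont_eps _ _) (Hc (circle z0 r t)
      ltac:(rewrite Cmod_circle; unfold r; lra)) (e' / 2) ltac:(lra)) as [s [Hs H]].
    exists (s / 2). split; [ lra |]. intros w k Hw Hk.
    assert (Hw' : Cmod (w - circle z0 r t) < s) by lra.
    assert (Hk' : Cmod (w + k - circle z0 r t) < s).
    { replace (w + k - circle z0 r t)%C with (w - circle z0 r t + k)%C by ring.
      eapply Rle_lt_trans; [ apply Cmod_triangle | lra ]. }
    assert (T := Cmod_between (f (w + k)%C) (f (circle z0 r t)) (f w)).
    assert (S1 := H _ Hw'). assert (S2 := H _ Hk').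
    rewrite (Cmod_minus_sym (f (circle z0 r t))) in T. lra. }
  destruct (proj1 (ccont_eps _ _) (Hc z0 ltac:(rewrite Cmod_self; lra)) e' He')
    as [d2 [Hd2 H2]].
  exists (Rmin r (Rmin d1 d2)). split; [ repeat apply Rmin_glb_lt; assumption |].
  intros w Hw. set (k := (w - z0)%C) in *.
  assert (Hk1 : Cmod k < r) by (eapply Rlt_le_trans; [ exact Hw | apply Rmin_l ]).
  assert (Hk2 : Cmod k < d1) by (eapply Rlt_le_trans; [ exact Hw |
    eapply Rle_trans; [ apply Rmin_r | apply Rmin_l ] ]).
  assert (Hk3 : Cmod k < d2) by (eapply Rlt_le_trans; [ exact Hw |
    eapply Rle_trans; [ apply Rmin_r | apply Rmin_r ] ]).
  replace w with (z0 + k)%C by (unfold k; ring).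
  destruct (cauchy_derivative_shifted f f1 z0 k r Hr Hf' Hk1) as [C1 E1].
  destruct (cauchy_derivative_shifted f f1 z0 0 r Hr Hf' ltac:(rewrite Cmod_0; lra))
    as [C0 E0].
  assert (Hb : Cmod (r * f1 (z0 + k)%C - r * f1 (z0 + 0)%C) <= 2 * e').
  { rewrite <- E1, <- E0, <- mean_minus by assumption.
    rewrite (mean_ext _ (fun t => ((f (circle z0 r t + k)%C - f (circle z0 r t))
      - (f (z0 + k)%C - f z0)) * Cconj (cis t))%C).
    - apply mean_conj_cis_le.
      + intros t Ht. apply continuous_ext with (f := fun t =>
          ((f (circle z0 r t + k)%C - f (z0 + k)%C) * Cconj (cis t)
          - (f (circle z0 r t + 0)%C - f (z0 + 0)%C) * Cconj (cis t))%C).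
        * intros s. rewrite !Cplus_0_r. ceq. ring.
        * apply continuous_Cminus; [ now apply C1 | now apply C0 ].
      + intros t Ht. specialize (H1 t k Ht Hk2).
        assert (H3 : Cmod (f (z0 + k)%C - f z0) < e')
          by (apply H2; now rewrite Cmod_add_sub).
        eapply Rle_trans; [ apply Cmod_triangle |]. rewrite Cmod_opp. lra.
    - intros t _. rewrite !Cplus_0_r. ring. }
  rewrite Cplus_0_r in Hb.
  replace (r * f1 (z0 + k)%C - r * f1 z0)%C with (r * (f1 (z0 + k)%C - f1 z0))%C in Hb by ring.
  rewrite Cmod_mult, Cmod_R, Rabs_pos_eq in Hb by lra.
  unfold e' in Hb. apply Rmult_lt_reg_l with r; [ exact Hr |]. nra.
Qed.

(** When [f1] is continuous, [f] is uniformly differentiable near the circle, and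
    Cauchy's formula can be differentiated under the integral sign. *)
Lemma derivative_holo_of_continuous (f f1 : C -> C) (z0 : C) (d : R) :
  0 < d -> (forall w, Cmod (w - z0) < d -> cderiv f w (f1 w) /\ ccont f1 w) -> holo f1 z0.
Proof.
  intros Hd Hf. set (r := d / 3). assert (Hr : 0 < r) by (unfold r; lra).
  assert (Hf' : forall w, Cmod (w - z0) < 3 * r -> cderiv f w (f1 w))
    by (intros w Hw; apply Hf; unfold r in Hw; lra).
  assert (Hn := RtoC_neq_0 r ltac:(lra)).
  set (L := mean (fun t => (f1 (circle z0 r t) - f1 z0) * Cconj (cis t))%C).
  assert (CL : cont01 (fun t => (f1 (circle z0 r t) - f1 z0) * Cconj (cis t))%C).
  { apply cis_conj_cont01. intros t Ht.
    apply continuous_Cminus; [| apply continuous_const ].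
    apply (circle_cont01 f1 z0 r); [| exact Ht ]. intros s _. apply Hf.
    rewrite Cmod_circle; unfold r; lra. }
  exists (L / r)%C. apply cderiv_eps. intros e He. set (e' := r * e / 2).
  assert (He' : 0 < e') by (unfold e'; nra).
  assert (Hloc : forall p, Cmod (p - z0) < 2 * r -> exists s, 0 < s /\ forall w k,
    Cmod (w - p) < s -> Cmod k < s -> Cmod (f (w + k)%C - f w - f1 w * k) <= e' * Cmod k).
  { intros p Hp.
    assert (HR : forall w, Cmod (w - p) < r -> cderiv f w (f1 w) /\ ccont f1 w).
    { intros w Hw. apply Hf. assert (T := Cmod_between w p z0). unfold r in *. lra. }
    destruct (strictly_differentiable f f1 p r Hr HR (e' / 2) ltac:(lra)) as [s [Hs H]].
    destruct (proj1 (ccont_eps _ _) (proj2 (HR p ltac:(rewrite Cmod_self; lra)))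
      (e' / 2) ltac:(lra)) as [s' [Hs' H']].
    exists (Rmin (s / 2) s'). split; [ apply Rmin_glb_lt; lra |]. intros w k Hw Hk.
    assert (Hw1 := Rlt_le_trans _ _ _ Hw (Rmin_l _ _)).
    assert (Hw2 := Rlt_le_trans _ _ _ Hw (Rmin_r _ _)).
    assert (Hk1 := Rlt_le_trans _ _ _ Hk (Rmin_l _ _)).
    assert (Hwk : Cmod (w + k - p) < s).
    { replace (w + k - p)%C with (w - p + k)%C by ring.
      eapply Rle_lt_trans; [ apply Cmod_triangle | lra ]. }
    specialize (H (w + k)%C w Hwk ltac:(lra)). specialize (H' w Hw2).
    replace (w + k - w)%C with k in H by ring.
    replace (f (w + k)%C - f w - f1 w * k)%C
      with ((f (w + k)%C - f w - f1 p * k) + - ((f1 w - f1 p) * k))%C by ring.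
    eapply Rle_trans; [ apply Cmod_triangle |]. rewrite Cmod_opp, Cmod_mult.
    assert (0 <= Cmod k) by apply Cmod_ge_0. nra. }
  destruct (uniform_on_path (circle z0 r)
    (fun w k => Cmod (f (w + k)%C - f w - f1 w * k) <= e' * Cmod k) 0 1)
    as [d1 [Hd1 H1]]; [ lra | intros; apply continuous_circle | |].
  { intros t _. apply Hloc. rewrite Cmod_circle; lra. }
  destruct (Hloc z0) as [d2 [Hd2 H2]]; [ rewrite Cmod_self; lra |].
  exists (Rmin r (Rmin d1 d2)). split; [ repeat apply Rmin_glb_lt; assumption |].
  intros w Hw. set (k := (w - z0)%C) in *.
  assert (Hk1 : Cmod k < r) by (eapply Rlt_le_trans; [ exact Hw | apply Rmin_l ]).
  assert (Hk2 : Cmod k < d1) by (eapply Rlt_le_trans; [ exact Hw |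
    eapply Rle_trans; [ apply Rmin_r | apply Rmin_l ] ]).
  assert (Hk3 : Cmod k < d2) by (eapply Rlt_le_trans; [ exact Hw |
    eapply Rle_trans; [ apply Rmin_r | apply Rmin_r ] ]).
  replace w with (z0 + k)%C by (unfold k; ring).
  destruct (cauchy_derivative_shifted f f1 z0 k r Hr Hf' Hk1) as [C1 E1].
  destruct (cauchy_derivative_shifted f f1 z0 0 r Hr Hf' ltac:(rewrite Cmod_0; lra))
    as [C0 E0].
  assert (CLk : cont01 (fun t => k * ((f1 (circle z0 r t) - f1 z0) * Cconj (cis t)))%C).
  { intros t Ht. apply continuous_Cmult; [ apply continuous_const | now apply CL ]. }
  assert (C10 : cont01 (fun t => (f (circle z0 r t + k)%C - f (z0 + k)%C) * Cconj (cis t)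
      - (f (circle z0 r t + 0)%C - f (z0 + 0)%C) * Cconj (cis t))%C).
  { intros t Ht. apply continuous_Cminus; [ now apply C1 | now apply C0 ]. }
  assert (Hb : Cmod (r * f1 (z0 + k)%C - r * f1 (z0 + 0)%C - k * L)
    <= 2 * e' * Cmod k).
  { unfold L. rewrite <- mean_scal by exact CL.
    rewrite <- E1, <- E0, <- mean_minus by assumption.
    rewrite <- mean_minus by assumption.
    rewrite (mean_ext _ (fun t =>
      ((f (circle z0 r t + k)%C - f (circle z0 r t) - f1 (circle z0 r t) * k)
      - (f (z0 + k)%C - f z0 - f1 z0 * k)) * Cconj (cis t))%C).
    - apply mean_conj_cis_le.
      + intros t Ht. apply continuous_ext with (f := fun t =>
          ((f (circle z0 r t + k)%C - f (z0 + k)%C) * Cconj (cis t)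
          - (f (circle z0 r t + 0)%C - f (z0 + 0)%C) * Cconj (cis t)
          - k * ((f1 (circle z0 r t) - f1 z0) * Cconj (cis t)))%C).
        * intros s. rewrite !Cplus_0_r. ceq. ring.
        * apply continuous_Cminus; [ now apply C10 | now apply CLk ].
      + intros t Ht. specialize (H1 t k Ht Hk2).
        specialize (H2 z0 k ltac:(rewrite Cmod_self; lra) Hk3).
        eapply Rle_trans; [ apply Cmod_triangle |]. rewrite Cmod_opp. lra.
    - intros t _. rewrite !Cplus_0_r. ring. }
  rewrite Cplus_0_r in Hb.
  replace (r * f1 (z0 + k)%C - r * f1 z0 - k * L)%C
    with (r * (f1 (z0 + k)%C - f1 z0 - L / r * k))%C in Hb by (field; exact Hn).
  rewrite Cmod_mult, Cmod_R, Rabs_pos_eq in Hb by lra.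
  unfold e' in Hb. apply Rmult_le_reg_l with r; [ exact Hr |]. lra.
Qed.

(** Continuity of [f1] around [z0] comes first, and allows differentiation under
    the integral sign. *)
Lemma derivative_holo (f f1 : C -> C) (z0 : C) (d : R) :
  0 < d -> (forall w, Cmod (w - z0) < d -> cderiv f w (f1 w)) -> holo f1 z0.
Proof.
  intros Hd Hf. apply (derivative_holo_of_continuous f f1 z0 d Hd). intros w Hw.
  split; [ now apply Hf |].
  apply (derivative_continuous f f1 w (d - Cmod (w - z0))); [ lra |].
  intros u Hu. apply Hf. assert (T := Cmod_between u w z0). lra.
Qed.

(** * Injective holomorphic functions have no critical points *)

(** A differential form of Harnack's inequality. Cauchy's formula gives [r * l] as
    the mean of [(p - p z) * Cconj (cis t)], and conjugating [mean_circle_moment]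
    shows that [Cconj (p - p z) * Cconj (cis t)] has mean 0. In the sum of the two
    only [2 * Re (p - p z)] is left; as [Re p] is nonnegative, its modulus is at
    most [2 * (Re p + Re (p z))], whose mean is [4 * Re (p z)]. *)
Lemma harnack_gradient (p : C -> C) (z l : C) (r : R) :
  0 < r -> (forall w, Cmod (w - z) <= r -> holo p w) ->
  (forall w, Cmod (w - z) <= r -> 0 <= Re (p w)) -> cderiv p z l ->
  r * Cmod l <= 4 * Re (p z).
Proof.
  intros Hr Hp Hpos Hl.
  assert (Hin : forall t, Cmod (circle z r t - z) <= r)
    by (intros; rewrite Cmod_circle; lra).
  assert (Hc : cont01 (fun t => p (circle z r t))).
  { apply circle_cont01. intros t _. now apply holo_continuous, Hp. }
  assert (Hd : cont01 (fun t => p (circle z r t) - p z)%C).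
  { intros t Ht. apply continuous_Cminus; [ now apply Hc | apply continuous_const ]. }
  assert (Hd1 := cis_conj_cont01 _ Hd).
  assert (Hd2 : cont01 (fun t => (p (circle z r t) - p z) * cis t)%C).
  { intros t Ht. apply continuous_Cmult; [ now apply Hd | apply continuous_cis ]. }
  assert (Hd3 : cont01 (fun t => Cconj ((p (circle z r t) - p z) * cis t))%C).
  { intros t Ht. now apply continuous_Cconj, Hd2. }
  assert (E : (r * l)%C = mean (fun t =>
    (p (circle z r t) - p z) * Cconj (cis t) + Cconj ((p (circle z r t) - p z) * cis t))%C).
  { rewrite mean_plus, mean_conj, mean_circle_moment, (cauchy_derivative p z l r) by auto.
    unfold Cconj, RtoC; simpl. rewrite Ropp_0. symmetry. apply Cplus_0_r. }
  assert (Hm : is_RInt (fun t => 2 * (Re (p (circle z r t)) + Re (p z))) 0 1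
                 (2 * (Re (p z) + Re (p z)))).
  { apply (@is_RInt_scal R_NormedModule).
    apply (@is_RInt_plus R_NormedModule).
    - rewrite <- (mean_value p z r Hr Hp) at 1. now apply mean_Re.
    - apply is_RInt_const_01. }
  replace (4 * Re (p z)) with (2 * (Re (p z) + Re (p z))) by ring.
  replace (r * Cmod l) with (Cmod (r * l)%C)
    by (rewrite Cmod_mult, Cmod_R, Rabs_pos_eq; lra).
  rewrite E. eapply mean_le; [| | exact Hm ].
  - intros t Ht. apply continuous_Cplus; [ now apply Hd1 | now apply Hd3 ].
  - intros t _.
    rewrite Cmult_conj, <- Cmult_plus_distr_r, Cmod_mult, Cmod_conj, Cmod_cis, Rmult_1_r.
    set (u := (p (circle z r t) - p z)%C).
    replace (u + Cconj u)%C with (RtoC (2 * Re u)).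
    2:{ unfold Cconj, RtoC, Cplus, Re. simpl. f_equal; ring. }
    rewrite Cmod_R. apply Rabs_le. unfold u, Re. simpl.
    assert (H1 := Hpos _ (Hin t)). assert (H2 := Hpos z ltac:(rewrite Cmod_self; lra)).
    unfold Re in H1, H2. lra.
Qed.

(** [u t * exp (k * t)] is nondecreasing. *)
Lemma gronwall_backward (u u' : R -> R) (k : R) :
  (forall t, 0 <= t <= 1 -> is_derive u t (u' t)) ->
  (forall t, 0 <= t <= 1 -> Rabs (u' t) <= k * u t) ->
  u 0 <= exp k * u 1.
Proof.
  intros Hd Hb.
  set (h := fun t => u t * exp (k * t)).
  set (h' := fun t => (u' t + k * u t) * exp (k * t)).
  assert (Hh : forall t, 0 <= t <= 1 -> is_derive h t (h' t)).
  { intros t Ht. unfold h, h'.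
    evar_last.
    - apply (is_derive_mult u (fun t => exp (k * t)) t); [ now apply Hd | |
        intros; apply Rmult_comm ].
      apply (is_derive_comp exp (fun t => k * t)); [ apply is_derive_exp |].
      apply (is_derive_scal (fun t => t)). apply is_derive_id.
    - unfold plus, mult, scal, one; simpl; unfold mult; simpl. ring. }
  destruct (MVT_gen h 0 1 h') as [c [Hc E]].
  - intros t Ht. rewrite Rmin_left, Rmax_right in Ht by lra. apply Hh. lra.
  - intros t Ht. rewrite Rmin_left, Rmax_right in Ht by lra.
    apply continuity_pt_filterlim, (@ex_derive_continuous R_AbsRing R_NormedModule).
    eexists. now apply Hh.
  - rewrite Rmin_left, Rmax_right in Hc by lra.
    specialize (Hb c Hc). apply Rabs_le_between in Hb.
    assert (0 <= h' c).
    { unfold h'. apply Rmult_le_pos; [ lra | apply Rlt_le, exp_pos ]. }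
    unfold h in E. rewrite Rmult_1_r, Rmult_0_r, exp_0 in E. lra.
Qed.

Lemma ball_convex (z : C) (r : R) : convex (fun w => Cmod (w - z) <= r).
Proof.
  intros p q t Hp Hq Ht.
  replace (p + RtoC t * (q - p) - z)%C
    with (RtoC (1 - t) * (p - z) + RtoC t * (q - z))%C by (rewrite RtoC_minus; ring).
  eapply Rle_trans; [ apply Cmod_triangle |].
  rewrite !Cmod_mult, !Cmod_R, !Rabs_pos_eq by lra. nra.
Qed.

Lemma ball_closed (z : C) (r : R) : seq_closed (fun w => Cmod (w - z) <= r).
Proof.
  intros w H. apply le_epsilon. intros e He. destruct (H e He) as [v [Hv Hd]].
  assert (T := Cmod_between w v z). rewrite Cmod_minus_sym in Hd. lra.
Qed.

Lemma is_derive_Re_along (f : C -> C) (p v l : C) (t : R) :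
  cderiv f (p + RtoC t * v) l ->
  is_derive (fun t => Re (f (p + RtoC t * v)%C)) t (Re (l * v)%C).
Proof.
  intros H. apply cderiv_along in H.
  apply (filterdiff_comp' (fun t => f (p + RtoC t * v)%C) (fun z : C_R_NormedModule => Re z)
    t _ (fun z : C_R_NormedModule => Re z)) in H.
  - exact H.
  - apply filterdiff_linear. apply (@is_linear_fst R_AbsRing R_NormedModule R_NormedModule).
Qed.

(** Harnack's inequality for the nonnegative harmonic function [- ln |q|]. It is
    the real part of [P - ln |q z0|], where [P] is the primitive of [- q' / q]
    with [P z0 = 0]: indeed [e^P * q] has derivative 0. The bound on the gradient
    is then integrated along the segment from [z0] to [z1]. *)
Lemma harnack_ln (q : C -> C) (z0 z1 : C) (r : R) :
  0 < r -> (forall w, Cmod (w - z0) < 4 * r -> holo q w /\ q w <> 0 /\ Cmod (q w) <= 1) ->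
  Cmod (z1 - z0) <= r ->
  - ln (Cmod (q z0)) <= exp 4 * - ln (Cmod (q z1)).
Proof.
  intros Hr Hq Hz1.
  set (q1 := C_derive q).
  assert (Hq1 : forall w, Cmod (w - z0) < 4 * r -> cderiv q w (q1 w)).
  { intros w Hw. apply holo_C_derive. now apply Hq. }
  (* The primitive lives on the disc of radius [3 * r], which contains the
     discs of radius [r] around all points of the segment. *)
  set (K := fun w => Cmod (w - z0) <= 3 * r).
  assert (HK := ball_convex z0 (3 * r)). assert (HKc := ball_closed z0 (3 * r)).
  fold K in HK, HKc.
  set (g := fun w => (- q1 w * / q w)%C).
  assert (Hg : forall w, K w -> holo g w).
  { intros w Hw. unfold K in Hw.
    destruct (derivative_holo q q1 w r Hr) as [q2 Hq2].
    { intros u Hu. apply Hq1. assert (T := Cmod_between u w z0). lra. }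
    destruct (Hq w ltac:(lra)) as [[l Hl] [Hn _]].
    eexists. unfold g. apply cderiv_mult; [| apply cderiv_inv; [ exact Hl | exact Hn ] ].
    apply cderiv_ext with (f := fun w => (-1 * q1 w)%C); [ intros; ring |].
    apply cderiv_scal, Hq2. }
  assert (Hz0 : K z0) by (unfold K; rewrite Cmod_self; lra).
  set (P := seg g z0).
  assert (HP : forall w, Cmod (w - z0) < 3 * r -> cderiv P w (g w)).
  { intros w Hw. apply (seg_primitive K); auto.
    exists (3 * r - Cmod (w - z0)). split; [ lra |]. intros u Hu. unfold K.
    assert (T := Cmod_between u w z0). lra. }
  assert (HE : forall w, Cmod (w - z0) < 3 * r -> (Cexp (P w) * q w = q z0)%C).
  { intros w Hw. transitivity (Cexp (P z0) * q z0)%C.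
    2:{ unfold P, seg. replace (z0 - z0)%C with (RtoC 0) by ring.
        rewrite Cmult_0_l, Cexp_RtoC, exp_0. ring. }
    symmetry. apply (cderiv_zero_const (fun w => Cexp (P w) * q w)%C). intros t Ht.
    set (u := (z0 + RtoC t * (w - z0))%C).
    assert (Hu : Cmod (u - z0) < 3 * r)
      by (apply Cmod_on_seg; auto; rewrite Cmod_self; lra).
    destruct (Hq u ltac:(lra)) as [_ [Hn _]].
    assert (D : cderiv (fun w => Cexp (P w) * q w)%C u
      ((Cexp (P u) * g u) * q u + Cexp (P u) * q1 u)).
    { apply (cderiv_mult (fun w => Cexp (P w)) q).
      - apply cderiv_comp; [ apply cderiv_Cexp | now apply HP ].
      - apply Hq1. lra. }
    replace ((Cexp (P u) * g u) * q u + Cexp (P u) * q1 u)%C with (RtoC 0) in D; [ exact D |].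
    unfold g. field. exact Hn. }
  set (kap := Cmod (q z0)).
  assert (HRe : forall w, Cmod (w - z0) < 3 * r -> Re (P w) - ln kap = - ln (Cmod (q w))).
  { intros w Hw. destruct (Hq w ltac:(lra)) as [_ [Hn _]].
    unfold kap. rewrite <- (HE w Hw), Cmod_mult, Cmod_Cexp.
    rewrite ln_mult, ln_exp; [ ring | apply exp_pos | now apply Cmod_gt_0 ]. }
  set (p := fun w => (P w - RtoC (ln kap))%C).
  assert (HRp : forall w, Re (p w) = Re (P w) - ln kap) by reflexivity.
  assert (Hp : forall w, Cmod (w - z0) < 3 * r -> cderiv p w (g w)).
  { intros w Hw. replace (g w) with (g w - 0)%C by ring.
    apply cderiv_minus; [ now apply HP | apply cderiv_const ]. }
  assert (Hpos : forall w, Cmod (w - z0) < 3 * r -> 0 <= Re (p w)).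
  { intros w Hw. rewrite HRp, HRe by exact Hw.
    destruct (Hq w ltac:(lra)) as [_ [Hn H1]]. apply Cmod_gt_0 in Hn.
    destruct H1 as [H1 | H1].
    - apply ln_increasing in H1; [| exact Hn ]. rewrite ln_1 in H1. lra.
    - rewrite H1, ln_1. lra. }
  unfold kap. rewrite <- (HRe z0), <- (HRe z1), <- (HRp z0), <- (HRp z1) by (rewrite ?Cmod_self; lra).
  assert (G := gronwall_backward (fun t => Re (p (z0 + RtoC t * (z1 - z0))%C))
    (fun t => Re (g (z0 + RtoC t * (z1 - z0))%C * (z1 - z0))%C) 4).
  cbv beta in G.
  replace (z0 + RtoC 0 * (z1 - z0))%C with z0 in G by ring.
  replace (z0 + RtoC 1 * (z1 - z0))%C with z1 in G by ring.
  apply G; intros t Ht; set (u := (z0 + RtoC t * (z1 - z0))%C);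
    assert (Hu : Cmod (u - z0) <= r)
      by (apply ball_convex; auto; rewrite Cmod_self; lra).
  - apply (is_derive_Re_along p z0 (z1 - z0)). apply Hp. fold u. lra.
  - eapply Rle_trans; [ apply re_le_Cmod |]. rewrite Cmod_mult.
    assert (H := harnack_gradient p u (g u) r Hr).
    assert (Hin : forall w, Cmod (w - u) <= r -> Cmod (w - z0) < 3 * r).
    { intros w Hw. assert (T := Cmod_between w u z0). lra. }
    assert (H' : r * Cmod (g u) <= 4 * Re (p u)).
    { apply H.
      - intros w Hw. eexists. now apply Hp, Hin.
      - intros w Hw. now apply Hpos, Hin.
      - apply Hp. lra. }
    assert (0 <= Cmod (g u)) by apply Cmod_ge_0. nra.
Qed.

(** The quotients [(f (w + h) - f w) / h] do not vanish, as [f] is injective,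
    and they tend to [f1 w]. If [f1 z0 = 0], they are bounded by 1 near [z0], and
    [f1 z1 <> 0] for some [z1] near [z0], as [f] is not locally constant.
    Harnack's inequality bounds the quotients at [z0] away from 0 in terms of those
    at [z1], uniformly in [h], which contradicts their convergence to 0. *)
Lemma injective_derivative_neq_0 (f f1 : C -> C) (z0 : C) (R0 : R) :
  0 < R0 -> (forall w, Cmod (w - z0) < R0 -> cderiv f w (f1 w)) ->
  (forall u w, Cmod (u - z0) < R0 -> Cmod (w - z0) < R0 -> f u = f w -> u = w) ->
  f1 z0 <> 0.
Proof.
  intros HR0 Hf Hinj E0.
  assert (Hc1 := derivative_continuous f f1 z0 R0 HR0 Hf).
  destruct (proj1 (ccont_eps _ _) Hc1 1 ltac:(lra)) as [d [Hd Hf1]].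
  set (r := Rmin R0 d / 5).
  assert (Hm : 0 < Rmin R0 d) by now apply Rmin_glb_lt.
  assert (Hr : 0 < r) by (unfold r; lra).
  assert (Hr1 : 5 * r <= R0) by (unfold r; assert (H := Rmin_l R0 d); lra).
  assert (Hr2 : 5 * r <= d) by (unfold r; assert (H := Rmin_r R0 d); lra).
  assert (Hz1 : exists z1, Cmod (z1 - z0) < r /\ f1 z1 <> 0).
  (* Otherwise [f] takes the same value at [z0] and at [z0 + r / 2]. *)
  { apply NNPP. intros Hno.
    set (w := (z0 + RtoC (r / 2))%C).
    assert (Hw : Cmod (w - z0) = r / 2).
    { unfold w. rewrite Cmod_add_sub, Cmod_R, Rabs_pos_eq; lra. }
    assert (E : z0 = w).
    { apply Hinj; [ rewrite Cmod_self; lra | lra |].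
      apply cderiv_zero_const. intros t Ht.
      assert (Hu : Cmod (z0 + RtoC t * (w - z0) - z0) < r)
        by (apply Cmod_on_seg; auto; rewrite ?Cmod_self; lra).
      assert (Ez : f1 (z0 + RtoC t * (w - z0))%C = 0).
      { apply NNPP. intros Hn. apply Hno. eexists. split; [ exact Hu | exact Hn ]. }
      rewrite <- Ez. apply Hf. lra. }
    rewrite <- E, Cmod_self in Hw. lra. }
  destruct Hz1 as [z1 [Hz1 Hn1]].
  set (q := fun h w => ((f (w + RtoC h)%C - f w) / RtoC h)%C).
  assert (Hq : forall h, 0 < h < r -> forall w, Cmod (w - z0) < 4 * r ->
    holo (q h) w /\ q h w <> 0 /\ Cmod (q h w) <= 1).
  { intros h Hh w Hw. assert (Hhn := RtoC_neq_0 h ltac:(lra)).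
    assert (Hch : Cmod (RtoC h) = h) by (rewrite Cmod_R, Rabs_pos_eq; lra).
    assert (Hwh : Cmod (w + RtoC h - z0) < 5 * r).
    { replace (w + RtoC h - z0)%C with (w - z0 + RtoC h)%C by ring.
      eapply Rle_lt_trans; [ apply Cmod_triangle |]. lra. }
    split; [| split ].
    - eexists. apply cderiv_ext with (f := fun w => (/ RtoC h * (f (w + RtoC h)%C - f w))%C).
      { intros u. unfold q. field. exact Hhn. }
      apply cderiv_scal, cderiv_minus.
      + apply cderiv_shift, Hf. lra.
      + apply Hf. lra.
    - unfold q. intros E.
      assert (E' : (f (w + RtoC h)%C - f w = 0)%C).
      { replace (f (w + RtoC h)%C - f w)%C with (RtoC h * ((f (w + RtoC h)%C - f w) / RtoC h))%C
          by (field; exact Hhn). rewrite E. ring. }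
      apply Ceq_minus, Hinj in E'; [| lra | lra ].
      apply Hhn. replace (RtoC h) with (w + RtoC h - w)%C by ring. rewrite E'. ring.
    - assert (Hseg : forall t, 0 <= t <= 1 ->
        Cmod (w + RtoC t * (w + RtoC h - w) - z0) < 5 * r)
        by (intros; apply Cmod_on_seg; auto; lra).
      assert (Hsc : seg_cont f1 w (w + RtoC h)).
      { intros t Ht. specialize (Hseg t Ht).
        apply (derivative_continuous f f1 _ (5 * r - Cmod (w + RtoC t * (w + RtoC h - w) - z0)));
          [ lra |].
        intros u Hu. apply Hf. assert (T := Cmod_between u (w + RtoC t * (w + RtoC h - w)) z0).
        lra. }
      unfold q. rewrite <- (seg_derivative f f1); [| exact Hsc |].
      2:{ intros t Ht. apply Hf. specialize (Hseg t Ht). lra. }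
      rewrite Cmod_div by exact Hhn. rewrite Hch.
      apply Rmult_le_reg_r with h; [ lra |]. unfold Rdiv. rewrite Rmult_assoc, Rinv_l by lra.
      rewrite Rmult_1_l, Rmult_1_r.
      apply Rle_trans with (Cmod (w + RtoC h - w) * 1);
        [| rewrite Cmod_add_sub, Hch; lra ].
      apply seg_le; [ exact Hsc |]. intros t Ht. apply Rlt_le.
      replace (f1 (w + RtoC t * (w + RtoC h - w))%C)
        with (f1 (w + RtoC t * (w + RtoC h - w))%C - f1 z0)%C by (rewrite E0; ring).
      apply Hf1. specialize (Hseg t Ht). lra. }
  (* [q h] converges to [f1] pointwise as [h] tends to 0. *)
  assert (Hlim : forall w e, 0 < e -> Cmod (w - z0) < R0 -> exists h0, 0 < h0 /\
    forall h, 0 < h < h0 -> Cmod (q h w - f1 w) <= e).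
  { intros w e He Hw. destruct (proj1 (cderiv_eps _ _ _) (Hf w Hw) e He) as [s [Hs H]].
    exists s. split; [ exact Hs |]. intros h Hh.
    assert (Hhn := RtoC_neq_0 h ltac:(lra)).
    assert (Hch : Cmod (RtoC h) = h) by (rewrite Cmod_R, Rabs_pos_eq; lra).
    specialize (H (w + RtoC h)%C). rewrite Cmod_add_sub, Hch in H.
    specialize (H ltac:(lra)). replace (w + RtoC h - w)%C with (RtoC h) in H by ring.
    replace (q h w - f1 w)%C with ((f (w + RtoC h)%C - f w - f1 w * RtoC h) / RtoC h)%C
      by (unfold q; field; exact Hhn).
    rewrite Cmod_div, Hch by exact Hhn. apply Rmult_le_reg_r with h; [ lra |].
    unfold Rdiv. rewrite Rmult_assoc, Rinv_l by lra. lra. }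
  set (m := Cmod (f1 z1) / 2).
  assert (Hmp : 0 < m) by (unfold m; apply Cmod_gt_0 in Hn1; lra).
  set (eps := exp (exp 4 * ln m) / 2).
  assert (Heps : 0 < eps) by (unfold eps; assert (H := exp_pos (exp 4 * ln m)); lra).
  destruct (Hlim z1 m Hmp ltac:(lra)) as [h1 [Hh1 L1]].
  destruct (Hlim z0 eps Heps ltac:(rewrite Cmod_self; lra)) as [h0 [Hh0 L0]].
  set (h := Rmin r (Rmin h0 h1) / 2).
  assert (Hmin : 0 < Rmin r (Rmin h0 h1)) by (repeat apply Rmin_glb_lt; assumption).
  assert (B1 := Rmin_l r (Rmin h0 h1)). assert (B2 := Rmin_r r (Rmin h0 h1)).
  assert (B3 := Rmin_l h0 h1). assert (B4 := Rmin_r h0 h1).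
  specialize (L1 h ltac:(unfold h; lra)). specialize (L0 h ltac:(unfold h; lra)).
  assert (Hh : 0 < h < r) by (unfold h; lra).
  assert (Hk := harnack_ln (q h) z0 z1 r Hr (Hq h Hh) ltac:(lra)).
  destruct (Hq h Hh z0 ltac:(rewrite Cmod_self; lra)) as [_ [Hq0 _]].
  apply Cmod_gt_0 in Hq0.
  rewrite E0 in L0. replace (q h z0 - 0)%C with (q h z0) in L0 by ring.
  assert (Hq1 : m <= Cmod (q h z1)).
  { assert (T := Cmod_triangle (q h z1) (f1 z1 - q h z1)).
    replace (q h z1 + (f1 z1 - q h z1))%C with (f1 z1) in T by ring.
    rewrite Cmod_minus_sym in L1. unfold m in *. lra. }
  assert (Hl1 : ln m <= ln (Cmod (q h z1))).
  { destruct Hq1 as [Hq1 | <-]; [| lra ]. now apply Rlt_le, ln_increasing. }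
  assert (Hl0 : exp 4 * ln m <= ln (Cmod (q h z0))).
  { assert (He4 := exp_pos 4). nra. }
  assert (exp (exp 4 * ln m) <= Cmod (q h z0)).
  { rewrite <- (exp_ln (Cmod (q h z0))) by exact Hq0.
    destruct Hl0 as [Hl0 | ->]; [ now apply Rlt_le, exp_increasing | lra ]. }
  unfold eps in *. lra.
Qed.

(** * Local inversion *)

(** The iteration [x + (w - F x) / c], the Newton method with constant slope,
    halves the error [w - F x] at each step. *)
Lemma newton_surjective (F : C -> C) (p c : C) (r : R) :
  c <> 0 -> 0 < r ->
  (forall x y, Cmod (x - p) <= r -> Cmod (y - p) <= r ->
     Cmod (F x - F y - c * (x - y)) <= Cmod c / 2 * Cmod (x - y)) ->
  forall w, Cmod (w - F p) <= Cmod c * r / 4 -> exists x, Cmod (x - p) <= r /\ F x = w.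
Proof.
  intros Hc Hr HF w Hw. assert (Hcp := proj1 (Cmod_gt_0 c) Hc).
  set (x := fun n => Nat.iter n (fun u => (u + (w - F u) / c)%C) p).
  assert (Hp2 : forall n, 0 < 2 ^ n) by (intros; apply pow_lt; lra).
  assert (Hstep : forall n, (x (S n) - x n = (w - F (x n)) / c)%C).
  { intros n. change (x (S n)) with (x n + (w - F (x n)) / c)%C. ring. }
  assert (Hst : forall n e, Cmod (w - F (x n)) <= Cmod c * e -> Cmod (x (S n) - x n) <= e).
  { intros n e H. rewrite Hstep, Cmod_div by exact Hc.
    apply Rmult_le_reg_l with (Cmod c); [ exact Hcp |].
    replace (Cmod c * (Cmod (w - F (x n)) / Cmod c)) with (Cmod (w - F (x n)))
      by (field; lra). exact H. }
  assert (Inv : forall n, Cmod (x n - p) <= r / 2 - r / 2 / 2 ^ n /\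
    Cmod (w - F (x n)) <= Cmod c * (r / 4 / 2 ^ n)).
  { induction n as [| n [I1 I2]].
    - change (x 0%nat) with p. rewrite Cmod_self, pow_O.
      unfold Rdiv in *. rewrite Rinv_1. lra.
    - assert (I3 := Hst n _ I2).
      assert (E2 : r / 2 / 2 ^ S n = r / 4 / 2 ^ n)
        by (simpl; specialize (Hp2 n); field; lra).
      assert (E3 : r / 2 / 2 ^ n = 2 * (r / 4 / 2 ^ n))
        by (specialize (Hp2 n); field; lra).
      assert (E4 : r / 4 / 2 ^ S n = r / 4 / 2 ^ n / 2)
        by (simpl; specialize (Hp2 n); field; lra).
      assert (P4 : 0 < r / 4 / 2 ^ n) by (apply Rdiv_lt_0_compat; [ lra | apply Hp2 ]).
      assert (T := Cmod_between (x (S n)) (x n) p).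
      split; [ lra |].
      replace (w - F (x (S n)))%C
        with (- (F (x (S n)) - F (x n) - c * (x (S n) - x n)))%C
        by (rewrite Hstep; field; exact Hc).
      rewrite Cmod_opp. eapply Rle_trans; [ apply HF; lra |]. rewrite E4.
      apply Rle_trans with (Cmod c / 2 * (r / 4 / 2 ^ n)); [| lra ].
      apply Rmult_le_compat_l; lra. }
  destruct (geometric_limit x (r / 4)) as [l Hl].
  { intros n. apply Hst, Inv. }
  assert (Hl' : forall n, Cmod (x n - l) <= r / 2 ^ n).
  { intros n. eapply Rle_trans; [ apply Hl |]. right. specialize (Hp2 n). field. lra. }
  assert (Hlp : Cmod (l - p) <= r).
  { destruct (Inv 1%nat) as [I1 _]. specialize (Hl' 1%nat). rewrite Cmod_minus_sym in Hl'.
    assert (T := Cmod_between l (x 1%nat) p). simpl in *. lra. }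
  exists l. split; [ exact Hlp |].
  apply Ceq_minus, Cmod_eq_0, Rle_antisym; [| apply Cmod_ge_0 ].
  apply le_epsilon. intros e He. rewrite Rplus_0_l.
  destruct (pow_lt_1_zero (/ 2) ltac:(rewrite Rabs_pos_eq; lra)
    (e / (2 * Cmod c * r)) ltac:(apply Rdiv_lt_0_compat; nra)) as [n Hn].
  specialize (Hn n (Nat.le_refl n)). rewrite Rabs_pos_eq in Hn by (apply pow_le; lra).
  rewrite pow_inv in Hn. destruct (Inv n) as [I1 I2]. specialize (Hl' n).
  assert (P : 0 < / 2 ^ n) by (apply Rinv_0_lt_compat, Hp2).
  unfold Rdiv in Hl', I1, I2.
  assert (H := HF l (x n) Hlp ltac:(nra)).
  rewrite (Cmod_minus_sym l (x n)) in H.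
  assert (T1 := Cmod_triangle (F l - F (x n) - c * (l - x n)) (c * (l - x n))).
  replace (F l - F (x n) - c * (l - x n) + c * (l - x n))%C
    with (F l - F (x n))%C in T1 by ring.
  rewrite Cmod_mult, (Cmod_minus_sym l (x n)) in T1.
  assert (T2 := Cmod_between (F l) (F (x n)) w).
  rewrite (Cmod_minus_sym (F (x n)) w) in T2.
  apply Rmult_lt_compat_r with (r := 2 * Cmod c * r) in Hn; [| nra ].
  replace (e / (2 * Cmod c * r) * (2 * Cmod c * r)) with e in Hn by (field; lra).
  assert (Cmod c * Cmod (x n - l) <= Cmod c * (r * / 2 ^ n))
    by (apply Rmult_le_compat_l; lra).
  lra.
Qed.

(** A holomorphic function with nonzero derivative is locally onto, with an
    estimate which makes any inverse Lipschitz. *)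
Lemma inverse_function (F F1 : C -> C) (z0 : C) (d : R) :
  0 < d -> (forall w, Cmod (w - z0) < d -> cderiv F w (F1 w)) -> F1 z0 <> 0 ->
  exists r, 0 < r /\
    (forall w, Cmod (w - F z0) < r -> exists x, Cmod (x - z0) < d /\ F x = w /\
       Cmod (F1 z0) * Cmod (x - z0) <= 2 * Cmod (w - F z0)).
Proof.
  intros Hd HF H0. set (c := F1 z0) in *. assert (Hcp := proj1 (Cmod_gt_0 c) H0).
  destruct (strictly_differentiable F F1 z0 d Hd) with (e := Cmod c / 2)
    as [s [Hs H]]; [| lra |].
  { intros w Hw. split; [ now apply HF |].
    apply (derivative_continuous F F1 w (d - Cmod (w - z0))); [ lra |].
    intros u Hu. apply HF. assert (T := Cmod_between u w z0). lra. }
  fold c in H.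
  set (r := Rmin s d / 2).
  assert (Hm : 0 < Rmin s d) by now apply Rmin_glb_lt.
  assert (M1 := Rmin_l s d). assert (M2 := Rmin_r s d).
  assert (Hr : 0 < r) by (unfold r; lra).
  assert (Hrs : r < s) by (unfold r; lra). assert (Hrd : r < d) by (unfold r; lra).
  exists (Rmin r (Cmod c * r / 4)).
  assert (Hcr : 0 < Cmod c * r / 4) by nra.
  assert (M4 := Rmin_r r (Cmod c * r / 4)).
  split; [ now apply Rmin_glb_lt |]. intros w Hw.
  destruct (newton_surjective F z0 c r H0 Hr) with (w := w) as [x [Hx1 Hx2]].
  - intros x y Hx Hy. apply H; lra.
  - lra.
  - exists x. split; [ lra | split; [ exact Hx2 |] ].
    assert (E := H x z0 ltac:(lra) ltac:(rewrite Cmod_self; lra)). rewrite Hx2 in E.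
    assert (T := Cmod_triangle (w - F z0) (- (w - F z0 - c * (x - z0)))).
    replace (w - F z0 + - (w - F z0 - c * (x - z0)))%C with (c * (x - z0))%C in T by ring.
    rewrite Cmod_opp, Cmod_mult in T. lra.
Qed.

Lemma cderiv_inverse (U : C -> Prop) (F F1 g : C -> C) (z0 : C) (d : R) :
  0 < d -> (forall w, Cmod (w - z0) < d -> U w /\ cderiv F w (F1 w)) -> F1 z0 <> 0 ->
  (forall x, U x -> g (F x) = x) -> holo g (F z0).
Proof.
  intros Hd HF H0 Hg. assert (Hcp := proj1 (Cmod_gt_0 _) H0).
  exists (/ F1 z0)%C. apply cderiv_eps. intros e He.
  assert (Hgz : g (F z0) = z0) by (apply Hg, HF; rewrite Cmod_self; lra).
  set (e' := Cmod (F1 z0) * Cmod (F1 z0) * e / 2).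
  assert (He' : 0 < e').
  { unfold e'. assert (0 < Cmod (F1 z0) * Cmod (F1 z0)) by now apply Rmult_lt_0_compat. nra. }
  destruct (proj1 (cderiv_eps _ _ _) (proj2 (HF z0 ltac:(rewrite Cmod_self; lra))) e' He')
    as [s [Hs H]].
  set (d' := Rmin d s). assert (Hd' : 0 < d') by now apply Rmin_glb_lt.
  assert (M1 : d' <= d) by apply Rmin_l. assert (M2 : d' <= s) by apply Rmin_r.
  destruct (inverse_function F F1 z0 d' Hd') as [r [Hr Hinv]];
    [ intros w Hw; apply HF; lra | exact H0 |].
  exists r. split; [ exact Hr |]. intros w Hw.
  destruct (Hinv w Hw) as [x [Hx1 [Hx2 Hx3]]].
  assert (Hgx : g w = x) by (rewrite <- Hx2; apply Hg, HF; lra).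
  rewrite Hgx, Hgz. specialize (H x ltac:(lra)). rewrite Hx2 in H.
  replace (x - z0 - / F1 z0 * (w - F z0))%C
    with (- (/ F1 z0 * (w - F z0 - F1 z0 * (x - z0))))%C by (field; exact H0).
  rewrite Cmod_opp, Cmod_mult, Cmod_inv by exact H0.
  apply Rmult_le_reg_l with (Cmod (F1 z0)); [ exact Hcp |].
  rewrite <- Rmult_assoc, Rinv_r, Rmult_1_l by lra.
  eapply Rle_trans; [ exact H |]. unfold e'.
  replace (Cmod (F1 z0) * Cmod (F1 z0) * e / 2 * Cmod (x - z0))
    with (Cmod (F1 z0) * e / 2 * (Cmod (F1 z0) * Cmod (x - z0))) by field.
  replace (Cmod (F1 z0) * (e * Cmod (w - F z0)))
    with (Cmod (F1 z0) * e / 2 * (2 * Cmod (w - F z0))) by field.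
  apply Rmult_le_compat_l; [ nra | exact Hx3 ].
Qed.

(** * The square root on the right half-plane *)

(** The principal square root, by the half-angle formula
    [Re (sqrt z) = sqrt ((|z| + Re z) / 2)]. *)
Definition Csqrt (z : C) : C :=
  let m := sqrt ((Cmod z + Re z) / 2) in (m, Im z / (2 * m)).

Lemma Csqrt_arg_pos (z : C) : 0 < Re z -> 0 < (Cmod z + Re z) / 2.
Proof. intros H. assert (P := Cmod_ge_0 z). lra. Qed.

Lemma Re_Csqrt_pos (z : C) : 0 < Re z -> 0 < Re (Csqrt z).
Proof. intros H. unfold Csqrt, Re at 1. simpl. now apply sqrt_lt_R0, Csqrt_arg_pos. Qed.

Lemma Csqrt_square (z : C) : 0 < Re z -> (Csqrt z * Csqrt z)%C = z.
Proof.
  intros H. assert (P := Re_Csqrt_pos z H). assert (Q := Csqrt_arg_pos z H).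
  unfold Csqrt, Re at 1 in P. simpl in P.
  set (m := sqrt ((Cmod z + Re z) / 2)) in *.
  assert (Em : m * m = (Cmod z + Re z) / 2) by (apply sqrt_sqrt; lra).
  assert (Ez : Cmod z * Cmod z = Re z * Re z + Im z * Im z).
  { assert (E := Cmod2_alt z). simpl in E. lra. }
  unfold Csqrt. fold m. unfold Cmult. simpl. destruct z as [x y].
  unfold Re, Im in *. simpl in *. f_equal.
  - replace (y / (2 * m) * (y / (2 * m))) with (y * y / (4 * (m * m))) by (field; lra).
    rewrite Em.
    replace (y * y) with ((Cmod (x, y) - x) * (Cmod (x, y) + x)) by lra.
    field. lra.
  - field. lra.
Qed.

Lemma Csqrt_real (x : R) : 0 < x -> Csqrt (RtoC (x * x)) = RtoC x.
Proof.
  intros Hx. unfold Csqrt, Re, Im. rewrite Cmod_R, Rabs_pos_eq by nra. simpl.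
  replace ((x * x + x * x) / 2) with (x * x) by field. rewrite sqrt_square by lra.
  unfold RtoC. f_equal. field. lra.
Qed.

Lemma continuous_Csqrt (z : C) : 0 < Re z -> ccont Csqrt z.
Proof.
  intros H. assert (P := Re_Csqrt_pos z H). unfold Csqrt, Re at 1 in P. simpl in P.
  assert (Hm : continuous (fun z : C_UniformSpace => sqrt ((Cmod z + Re z) / 2)) z).
  { apply (continuous_comp (fun z : C => (Cmod z + Re z) / 2) sqrt).
    - apply (@continuous_mult C_UniformSpace R_AbsRing); [| apply continuous_const ].
      apply (@continuous_plus C_UniformSpace R_AbsRing R_NormedModule).
      + apply (continuous_mod (fun z : C => z)), continuous_id.
      + apply (continuous_Re (fun z : C => z)), continuous_id.
    - apply continuous_sqrt. }
  apply continuous_pair; [ exact Hm |].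
  apply (@continuous_mult C_UniformSpace R_AbsRing).
  - apply (continuous_Im (fun z : C => z)), continuous_id.
  - apply (continuous_comp (fun z : C => 2 * sqrt ((Cmod z + Re z) / 2)) Rinv).
    + apply (@continuous_mult C_UniformSpace R_AbsRing); [ apply continuous_const | exact Hm ].
    + apply continuous_Rinv. lra.
Qed.

Lemma Re_pos_neq_0 (z : C) : 0 < Re z -> z <> 0.
Proof. intros H E. rewrite E in H. simpl in H. lra. Qed.

(** [w - z = (sqrt w - sqrt z) (sqrt w + sqrt z)], so the difference quotient is
    [1 / (sqrt w + sqrt z)]. *)
Lemma holo_Csqrt (z : C) : 0 < Re z -> holo Csqrt z.
Proof.
  intros H. assert (P := Re_Csqrt_pos z H).
  exists (/ (Csqrt z + Csqrt z))%C.
  apply cderiv_ext_loc with (d := Re z)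
    (f := fun w => (Csqrt z + / (Csqrt w + Csqrt z) * (w - z))%C); [ exact H | |].
  - intros w Hw. assert (Hwp : 0 < Re w).
    { assert (B := Cmod_fst (w - z)). simpl in B. apply Rabs_le_between in B.
      unfold Re in *. lra. }
    assert (Pw := Re_Csqrt_pos w Hwp).
    assert (Hn : (Csqrt w + Csqrt z)%C <> 0)
      by (apply Re_pos_neq_0; rewrite re_plus; lra).
    rewrite <- (Csqrt_square w Hwp) at 2. rewrite <- (Csqrt_square z H) at 3.
    field. exact Hn.
  - exists (fun w => / (Csqrt w + Csqrt z))%C. split; [| split; [ easy |] ].
    + intros w. replace (z - z)%C with (RtoC 0) by ring. ring.
    + apply continuous_Cinv; [| apply Re_pos_neq_0; rewrite re_plus; lra ].
      apply continuous_Cplus; [ now apply continuous_Csqrt | apply continuous_const ].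
Qed.

(** * Rectangles around a real segment *)

Lemma segment_neighbourhood (Q : C -> Prop) (a b : R) :
  a <= b ->
  (forall t, a <= t <= b -> exists r, 0 < r /\ forall w, Cmod (w - RtoC t) < r -> Q w) ->
  exists h, 0 < h /\ forall z, a - h < Re z < b + h -> - h < Im z < h -> Q z.
Proof.
  intros Hab HQ.
  destruct (uniform_on_path RtoC (fun w k => Q (w + k)%C) a b Hab) as [d [Hd H]].
  - intros t _. apply (continuous_RtoC (fun t : R => t)), continuous_id.
  - intros t Ht. destruct (HQ t Ht) as [r [Hr Hw]]. exists (r / 2). split; [ lra |].
    intros w k H1 H2. apply Hw.
    replace (w + k - RtoC t)%C with (w - RtoC t + k)%C by ring.
    eapply Rle_lt_trans; [ apply Cmod_triangle | lra ].
  - exists (d / 3). split; [ lra |]. intros z Hx Hy.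
    set (t := Rmax a (Rmin b (Re z))).
    assert (Ht : a <= t <= b).
    { split; [ apply Rmax_l |]. apply Rmax_lub; [ exact Hab | apply Rmin_l ]. }
    replace z with (RtoC t + (z - RtoC t))%C by ring. apply H; [ exact Ht |].
    apply Rle_lt_trans with (2 * (d / 3)); [| lra ].
    apply Cmod_pair_le; unfold Re, Im in *; simpl; apply Rabs_le; [| lra ].
    unfold t, Rmax, Rmin. repeat destruct (Rle_dec _ _); lra.
Qed.

Definition rectangle (p q h : R) (z : C) : Prop := p < Re z < q /\ - h < Im z < h.
Definition closed_rectangle (p q h : R) (z : C) : Prop := p <= Re z <= q /\ - h <= Im z <= h.

Lemma closed_rectangle_convex (p q h : R) : convex (closed_rectangle p q h).
Proof.
  intros u v t [Hu1 Hu2] [Hv1 Hv2] Ht. unfold closed_rectangle, Re, Im in *. simpl.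
  split; split; nra.
Qed.

Lemma closed_rectangle_closed (p q h : R) : seq_closed (closed_rectangle p q h).
Proof.
  intros z H.
  assert (Hz : forall e, 0 < e -> p <= Re z + e /\ Re z <= q + e /\
    - h <= Im z + e /\ Im z <= h + e).
  { intros e He. destruct (H e He) as [w [[H1 H2] Hw]].
    assert (B1 := Cmod_fst (w - z)). assert (B2 := Cmod_snd (w - z)). simpl in B1, B2.
    apply Rabs_le_between in B1, B2. unfold Re, Im in *. lra. }
  split; split; apply le_epsilon; intros e He; specialize (Hz e He); lra.
Qed.

Lemma Rlt_on_segment (p q x y t : R) :
  p < x < q -> p < y < q -> 0 <= t <= 1 -> p < x + t * (y - x) < q.
Proof. intros Hx Hy Ht. destruct (Rle_dec x y); split; nra. Qed.

Lemma rectangle_convex (p q h : R) : convex (rectangle p q h).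
Proof.
  intros u v t [Hu1 Hu2] [Hv1 Hv2] Ht. unfold rectangle.
  assert (H1 := Rlt_on_segment _ _ _ _ _ Hu1 Hv1 Ht).
  assert (H2 := Rlt_on_segment _ _ _ _ _ Hu2 Hv2 Ht).
  unfold Re, Im in *. simpl. lra.
Qed.

Lemma rectangle_open (p q h : R) (z : C) :
  rectangle p q h z -> exists d, 0 < d /\ forall w, Cmod (w - z) < d -> rectangle p q h w.
Proof.
  intros [H1 H2].
  exists (Rmin (Rmin (Re z - p) (q - Re z)) (Rmin (Im z + h) (h - Im z))).
  split; [ repeat apply Rmin_glb_lt; lra |]. intros w Hw.
  assert (B1 := Cmod_fst (w - z)). assert (B2 := Cmod_snd (w - z)). simpl in B1, B2.
  apply Rabs_le_between in B1, B2.
  assert (M1 := Rmin_l (Rmin (Re z - p) (q - Re z)) (Rmin (Im z + h) (h - Im z))).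
  assert (M2 := Rmin_r (Rmin (Re z - p) (q - Re z)) (Rmin (Im z + h) (h - Im z))).
  assert (M3 := Rmin_l (Re z - p) (q - Re z)). assert (M4 := Rmin_r (Re z - p) (q - Re z)).
  assert (M5 := Rmin_l (Im z + h) (h - Im z)). assert (M6 := Rmin_r (Im z + h) (h - Im z)).
  unfold rectangle, Re, Im in *. lra.
Qed.

(** * The length of a differentiable curve *)

(** Differentiability at [t], in terms of increments over intervals around [t];
    such intervals are those that Cousin's principle provides. *)
Definition straddle (gamma : R -> C) (a b t : R) (l : C) : Prop :=
  forall e, 0 < e -> exists d, 0 < d /\ forall u v, a <= u <= t -> t <= v <= b ->
    t - d < u -> v < t + d ->
    Cmod (gamma v - gamma u - l * RtoC (v - u)) <= e * (v - u).

Lemma cderiv_straddle (F : C -> C) (a b t : R) (l : C) :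
  cderiv F (RtoC t) l -> straddle (fun x => F (RtoC x)) a b t l.
Proof.
  intros H e He. destruct (proj1 (cderiv_eps _ _ _) H e He) as [d [Hd Hw]].
  exists d. split; [ exact Hd |]. intros u v Hu Hv Hud Hvd.
  assert (Hx : forall x, Cmod (RtoC x - RtoC t) = Rabs (x - t))
    by (intros; rewrite <- RtoC_minus; apply Cmod_R).
  assert (Au : Rabs (u - t) = t - u) by (rewrite Rabs_left1; lra).
  assert (Av : Rabs (v - t) = v - t) by (rewrite Rabs_pos_eq; lra).
  assert (H1 := Hw (RtoC u)). assert (H2 := Hw (RtoC v)).
  rewrite Hx in H1, H2. rewrite Au in H1. rewrite Av in H2.
  specialize (H1 ltac:(lra)). specialize (H2 ltac:(lra)).
  replace (F (RtoC v) - F (RtoC u) - l * RtoC (v - u))%C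
    with ((F (RtoC v) - F (RtoC t) - l * (RtoC v - RtoC t))
      + - (F (RtoC u) - F (RtoC t) - l * (RtoC u - RtoC t)))%C
    by (rewrite RtoC_minus; ring).
  eapply Rle_trans; [ apply Cmod_triangle |]. rewrite Cmod_opp. lra.
Qed.

Lemma straddle_speed (gamma : R -> C) (ell : R -> R) (a b t e : R) (l : C) :
  straddle gamma a b t l -> straddle (fun x => RtoC (ell x)) a b t (Cmod l) -> 0 < e ->
  exists d, 0 < d /\ forall u v, a <= u <= t -> t <= v <= b -> t - d < u -> v < t + d ->
    Rabs (Cmod (gamma v - gamma u) - (ell v - ell u)) <= e * (v - u).
Proof.
  intros Hg Hl He.
  destruct (Hg (e / 2) ltac:(lra)) as [d1 [Hd1 H1]].
  destruct (Hl (e / 2) ltac:(lra)) as [d2 [Hd2 H2]].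
  exists (Rmin d1 d2). split; [ now apply Rmin_glb_lt |]. intros u v Hu Hv Hud Hvd.
  assert (M1 := Rmin_l d1 d2). assert (M2 := Rmin_r d1 d2).
  specialize (H1 u v Hu Hv ltac:(lra) ltac:(lra)).
  specialize (H2 u v Hu Hv ltac:(lra) ltac:(lra)).
  rewrite <- !RtoC_minus, <- RtoC_mult, <- RtoC_minus, Cmod_R in H2.
  set (D := (gamma v - gamma u)%C) in *.
  assert (T1 := Cmod_triangle (D - l * RtoC (v - u)) (l * RtoC (v - u))).
  assert (T2 := Cmod_triangle D (- (D - l * RtoC (v - u)))).
  replace (D - l * RtoC (v - u) + l * RtoC (v - u))%C with D in T1 by ring.
  replace (D + - (D - l * RtoC (v - u)))%C with (l * RtoC (v - u))%C in T2 by ring.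
  rewrite Cmod_opp in T2. rewrite Cmod_mult, Cmod_R, Rabs_pos_eq in T1, T2 by lra.
  apply Rabs_le_between in H2. apply Rabs_le. lra.
Qed.

(** [ell] grows at the speed of [gamma]; the derivative of [ell] is the modulus
    of that of [gamma]. *)
Definition integrates_speed (gamma : R -> C) (ell : R -> R) (a b : R) : Prop :=
  forall t, a <= t <= b -> exists l,
    straddle gamma a b t l /\ straddle (fun x => RtoC (ell x)) a b t (Cmod l).

(** Up to [e * (v - u)] the inequality holds over small intervals, and it is
    additive by the triangle inequality. *)
Lemma chord_le (gamma : R -> C) (ell : R -> R) (a b x y : R) :
  integrates_speed gamma ell a b ->
  a <= x -> x <= y -> y <= b -> Cmod (gamma y - gamma x) <= ell y - ell x.
Proof.
  intros speed Hx Hxy Hy. apply le_epsilon. intros e He.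
  set (e' := e / (y - x + 1)).
  assert (He' : 0 < e') by (apply Rdiv_lt_0_compat; lra).
  assert (H : Cmod (gamma y - gamma x) <= ell y - ell x + e' * (y - x)).
  { apply (cousin (fun u v => Cmod (gamma v - gamma u) <= ell v - ell u + e' * (v - u)) x y Hxy).
    - intros u v w _ _ _ _ H1 H2. assert (T := Cmod_between (gamma w) (gamma v) (gamma u)).
      lra.
    - intros t Ht. destruct (speed t ltac:(lra)) as [l [Hg Hl]].
      destruct (straddle_speed gamma ell a b t e' l Hg Hl He') as [d [Hd H]].
      exists d. split; [ exact Hd |]. intros u v H1 H2 H3 H4 H5 H6.
      specialize (H u v ltac:(lra) ltac:(lra) H5 H6).
      apply Rabs_le_between in H. lra. }
  assert (e' * (y - x) <= e); [| lra ].
  apply Rmult_le_reg_r with (y - x + 1); [ lra |].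
  replace (e' * (y - x) * (y - x + 1)) with (e * (y - x)) by (unfold e'; field; lra).
  nra.
Qed.

Lemma partition_range (tau : nat -> R) (n : nat) (c d : R) :
  partition c d tau n -> forall i, (i <= S n)%nat -> c <= tau i <= d.
Proof.
  intros [H0 [H1 Hm]].
  assert (Hlow : forall i, (i <= S n)%nat -> c <= tau i).
  { induction i as [| i IH]; intros Hi; [ lra |].
    specialize (Hm i ltac:(lia)). specialize (IH ltac:(lia)). lra. }
  assert (Hup : forall k i, (i + k = S n)%nat -> tau i <= d).
  { induction k as [| k IH]; intros i Hi.
    - replace i with (S n) by lia. lra.
    - specialize (Hm i ltac:(lia)). specialize (IH (S i) ltac:(lia)). lra. }
  intros i Hi. split; [ auto | apply (Hup (S n - i)%nat); lia ].
Qed.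

Lemma polygon_length_le (gamma : R -> C) (ell : R -> R) (a b : R)
    (tau : nat -> R) (n : nat) :
  integrates_speed gamma ell a b ->
  partition a b tau n -> polygon_length gamma tau n <= ell b - ell a.
Proof.
  intros speed H. assert (Hr := partition_range tau n a b H). destruct H as [H0 [H1 Hm]].
  assert (Hk : forall k, (k <= n)%nat ->
    sum_f_R0 (fun i => Cmod (gamma (tau (S i)) - gamma (tau i))%C) k
      <= ell (tau (S k)) - ell a).
  { induction k as [| k IH]; intros Hk.
    - simpl. rewrite H0. apply (chord_le gamma ell a b _ _ speed); [ lra | | apply (Hr 1%nat); lia ].
      rewrite <- H0. apply Hm. lia.
    - simpl sum_f_R0.
      assert (B1 := Hr (S k) ltac:(lia)). assert (B2 := Hr (S (S k)) ltac:(lia)).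
      assert (C1 := chord_le gamma ell a b (tau (S k)) (tau (S (S k))) speed ltac:(lra) ltac:(apply Hm; lia)
        ltac:(lra)).
      specialize (IH ltac:(lia)). lra. }
  unfold polygon_length. rewrite <- H1. apply Hk. lia.
Qed.

(** Cousin's principle applied to the relation that any polygon up to [u] extends
    to a polygon up to [v] which gains at least [ell v - ell u - e * (v - u)].
    Stated in this way it is transitive, and locally one new node is enough. *)
Lemma polygon_length_approx (gamma : R -> C) (ell : R -> R) (a b e : R) :
  integrates_speed gamma ell a b ->
  a <= b -> 0 < e -> exists tau n,
    partition a b tau n /\ ell b - ell a - e * (b - a) <= polygon_length gamma tau n.
Proof.
  intros speed Hab He.
  assert (H : forall tau n, partition a a tau n -> exists tau' n', partition a b tau' n' /\
    polygon_length gamma tau n + (ell b - ell a - e * (b - a))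
      <= polygon_length gamma tau' n').
  { apply (cousin (fun u v => forall tau n, partition a u tau n -> exists tau' n',
      partition a v tau' n' /\ polygon_length gamma tau n + (ell v - ell u - e * (v - u))
        <= polygon_length gamma tau' n') a b Hab).
    - intros u v w _ _ _ _ H1 H2 tau n Hp.
      destruct (H1 tau n Hp) as [tau1 [n1 [Hp1 L1]]].
      destruct (H2 tau1 n1 Hp1) as [tau2 [n2 [Hp2 L2]]].
      exists tau2, n2. split; [ exact Hp2 | lra ].
    - intros t Ht. destruct (speed t Ht) as [l [Hg Hl]].
      destruct (straddle_speed gamma ell a b t e l Hg Hl He) as [d [Hd H]].
      exists d. split; [ exact Hd |]. intros u v H1 H2 H3 H4 H5 H6 tau n [P0 [P1 Pm]].
      specialize (H u v ltac:(lra) ltac:(lra) H5 H6). apply Rabs_le_between in H.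
      (* The node [v] is appended to the partition. *)
      set (tau' := fun i => if le_lt_dec i (S n) then tau i else v).
      assert (E1 : forall i, (i <= S n)%nat -> tau' i = tau i).
      { intros i Hi. unfold tau'. destruct (le_lt_dec i (S n)); [ easy | lia ]. }
      assert (E2 : tau' (S (S n)) = v).
      { unfold tau'. destruct (le_lt_dec (S (S n)) (S n)); [ lia | easy ]. }
      exists tau', (S n). split.
      + split; [ rewrite E1 by lia; exact P0 | split; [ exact E2 |] ].
        intros i Hi. destruct (Nat.eq_dec i (S n)) as [-> | Hne].
        * rewrite E2, E1, P1 by lia. lra.
        * rewrite !E1 by lia. apply Pm. lia.
      + unfold polygon_length. simpl sum_f_R0.
        rewrite E2, (E1 (S n)), P1 by lia.
        rewrite (sum_eq (fun i => Cmod (gamma (tau' (S i)) - gamma (tau' i))%C)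
          (fun i => Cmod (gamma (tau (S i)) - gamma (tau i))%C) n).
        * lra.
        * intros i Hi. now rewrite !E1 by lia. }
  destruct (H (fun _ => a) 0%nat) as [tau [n [Hp L]]].
  - split; [ easy | split; [ easy | intros; lra ] ].
  - exists tau, n. split; [ exact Hp |].
    unfold polygon_length at 1 in L. simpl in L. rewrite Cmod_self in L. lra.
Qed.

Lemma curve_length_speed (gamma : R -> C) (ell : R -> R) (a b : R) :
  integrates_speed gamma ell a b -> a <= b ->
  curve_length gamma a b = Finite (ell b - ell a).
Proof.
  intros speed Hab. apply is_lub_Rbar_unique. split.
  - intros l [tau [n [Hp ->]]]. now apply (polygon_length_le gamma ell).
  - intros m Hm. destruct m as [m | |]; simpl; [| exact I |].
    + apply le_epsilon. intros e He. set (e' := e / (b - a + 1)).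
      assert (He' : 0 < e') by (apply Rdiv_lt_0_compat; lra).
      destruct (polygon_length_approx gamma ell a b e' speed Hab He') as [tau [n [Hp L]]].
      assert (Hle : polygon_length gamma tau n <= m)
        by (apply (Hm (polygon_length gamma tau n)); now exists tau, n).
      assert (e' * (b - a) <= e); [| lra ].
      apply Rmult_le_reg_r with (b - a + 1); [ lra |].
      replace (e' * (b - a) * (b - a + 1)) with (e * (b - a)) by (unfold e'; field; lra).
      nra.
    + destruct (polygon_length_approx gamma ell a b 1 speed Hab ltac:(lra)) as [tau [n [Hp _]]].
      apply (Hm (polygon_length gamma tau n)). now exists tau, n.
Qed.

(** * Conformal maps and arc length *)

Lemma open_iff_balls (V : C -> Prop) :
  open V <-> forall z, V z -> exists d, 0 < d /\ forall w, Cmod (w - z) < d -> V w.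
Proof. split; intros H z Hz; apply locally_Cmod; now apply H. Qed.

Lemma conformal_cderiv (V : C -> Prop) (f : C -> C) (z : C) :
  conformal_on V f -> V z -> cderiv f z (C_derive f z).
Proof.
  intros [H _] Hz. destruct (H z Hz) as [l Hl]. apply holo_C_derive.
  exists l. now apply is_derive_cderiv.
Qed.

Lemma conformal_intro (V : C -> Prop) (f : C -> C) :
  (forall z, V z -> holo f z) -> (forall z w, V z -> V w -> f z = f w -> z = w) ->
  conformal_on V f.
Proof.
  intros Hf Hinj. split; [| exact Hinj ]. intros z Hz. destruct (Hf z Hz) as [l Hl].
  exists l. now apply is_derive_cderiv.
Qed.

Lemma conformal_derive_neq_0 (V : C -> Prop) (f : C -> C) (z : C) :
  open V -> conformal_on V f -> V z -> C_derive f z <> 0.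
Proof.
  intros HV Hf Hz. destruct (proj1 (open_iff_balls V) HV z Hz) as [d [Hd Hw]].
  apply (injective_derivative_neq_0 f (C_derive f) z d Hd).
  - intros w H. apply (conformal_cderiv V); auto.
  - intros u w Hu Hv. apply Hf; auto.
Qed.

Lemma conformal_holo_derive (V : C -> Prop) (f : C -> C) (z : C) :
  open V -> conformal_on V f -> V z -> holo (C_derive f) z.
Proof.
  intros HV Hf Hz. destruct (proj1 (open_iff_balls V) HV z Hz) as [d [Hd Hw]].
  apply (derivative_holo f (C_derive f) z d Hd).
  intros w H. apply (conformal_cderiv V); auto.
Qed.

(** The increment of [G] is [w - z] times a mean of values of [g], which has a
    positive real part. *)
Lemma Re_derivative_pos_injective (g G : C -> C) (z w : C) :
  seg_cont g z w -> (forall t, 0 <= t <= 1 ->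
    cderiv G (z + RtoC t * (w - z)) (g (z + RtoC t * (w - z))%C) /\
    0 < Re (g (z + RtoC t * (w - z))%C)) ->
  G z = G w -> z = w.
Proof.
  intros Hc Hg E.
  assert (D := seg_derivative G g z w Hc (fun t Ht => proj1 (Hg t Ht))).
  assert (Hcc := seg_cont01 g z w Hc).
  assert (Hpos : 0 < Re (mean (fun t => g (z + RtoC t * (w - z))%C))).
  { rewrite <- (is_RInt_unique _ _ _ _ (mean_Re _ Hcc)). apply RInt_gt_0; [ lra | |].
    - intros t Ht. apply Hg. lra.
    - intros t Ht. apply continuous_Re. now apply Hcc. }
  apply Re_pos_neq_0 in Hpos. rewrite E in D.
  replace (G w - G w)%C with (RtoC 0) in D by ring. unfold seg in D.
  apply NNPP. intros Hne. apply Cmult_neq_0 in D; auto.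
  apply Cminus_eq_contra. congruence.
Qed.

(** On the real axis the square of the speed is
    [phi' t * Cconj (phi' (Cconj t))], a holomorphic function which is positive
    there since [phi'] does not vanish. So it has a positive real part on a
    rectangle around the segment, and its principal square root extends the speed. *)
Lemma speed_extension (a b : R) (V : C -> Prop) (phi : C -> C) :
  a < b -> open V -> contains_segment V a b -> conformal_on V phi ->
  exists h g, 0 < h /\ (forall z, closed_rectangle (a - h) (b + h) h z ->
    V z /\ holo g z /\ 0 < Re (g z)) /\
    (forall t, a <= t <= b -> g (RtoC t) = RtoC (Cmod (C_derive phi (RtoC t)))).
Proof.
  intros Hab HV Hseg Hphi.
  set (phi1 := C_derive phi).
  assert (Hphi1 : forall z, V z -> holo phi1 z)
    by (intros; now apply (conformal_holo_derive V)).
  set (P := fun w => (phi1 w * Cconj (phi1 (Cconj w)))%C).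
  assert (HP : forall z, V z -> V (Cconj z) -> holo P z).
  { intros z H1 H2. destruct (Hphi1 z H1) as [l Hl], (Hphi1 _ H2) as [m Hm].
    eexists. apply (cderiv_mult phi1); [ exact Hl | apply cderiv_reflect, Hm ]. }
  assert (Hconj : forall t, Cconj (RtoC t) = RtoC t)
    by (intros t; unfold Cconj, RtoC; simpl; f_equal; ring).
  assert (HPt : forall t, P (RtoC t) = RtoC (Cmod (phi1 (RtoC t)) * Cmod (phi1 (RtoC t)))).
  { intros t. unfold P. rewrite Hconj, <- Cmod2_conj. f_equal. ring. }
  assert (Hpos : forall t, a <= t <= b -> 0 < Cmod (phi1 (RtoC t))).
  { intros t Ht. apply Cmod_gt_0, (conformal_derive_neq_0 V); auto. }
  destruct (segment_neighbourhood (fun w => V w /\ V (Cconj w) /\ 0 < Re (P w)) a b)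
    as [h [Hh H]]; [ lra | |].
  { intros t Ht. destruct (proj1 (open_iff_balls V) HV _ (Hseg t Ht)) as [d [Hd Hw]].
    assert (Hc := holo_continuous P (RtoC t)
      (HP _ (Hseg t Ht) ltac:(rewrite Hconj; now apply Hseg))).
    specialize (Hpos t Ht).
    destruct (proj1 (ccont_eps _ _) Hc (Re (P (RtoC t)))) as [d' [Hd' Hw']].
    { rewrite HPt. simpl. nra. }
    exists (Rmin d d'). split; [ now apply Rmin_glb_lt |]. intros w Hwt.
    assert (Hw1 := Rlt_le_trans _ _ _ Hwt (Rmin_l _ _)).
    assert (Hw2 := Rlt_le_trans _ _ _ Hwt (Rmin_r _ _)).
    split; [ now apply Hw | split ].
    - apply Hw. rewrite <- Hconj, <- Cminus_conj, Cmod_conj. exact Hw1.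
    - specialize (Hw' w Hw2). revert Hw'.
      generalize (P w) (P (RtoC t)). intros u v Huv.
      assert (B := Cmod_fst (u - v)).
      apply Rabs_le_between in B. unfold Re in *. simpl in B. lra. }
  (* Half of [h], so that the closed rectangle lies in the open one. *)
  exists (h / 2), (fun w => Csqrt (P w)). split; [ lra | split ].
  - intros z [[H1 H2] [H3 H4]].
    destruct (H z ltac:(lra) ltac:(lra)) as [Q1 [Q2 Q3]].
    split; [ exact Q1 | split; [| now apply Re_Csqrt_pos ] ].
    destruct (holo_Csqrt (P z) Q3) as [l Hl], (HP z Q1 Q2) as [m Hm].
    eexists. apply cderiv_comp; [ exact Hl | exact Hm ].
  - intros t Ht. rewrite HPt. now apply Csqrt_real, Hpos.
Qed.

(** A function with real derivative along a real segment has real increments,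
    given by the integral of that derivative. *)
Lemma real_primitive (G : C -> C) (v : R -> R) (a t : R) :
  a <= t -> (forall x, a <= x <= t -> cderiv G (RtoC x) (RtoC (v x)) /\ continuous v x) ->
  G (RtoC t) = (G (RtoC a) + RtoC (RInt v a t))%C.
Proof.
  intros Hat HG.
  assert (H := @is_RInt_derive C_R_CompleteNormedModule
    (fun x => G (0 + RtoC x * 1)%C) (fun x => (RtoC (v x) * 1)%C) a t).
  rewrite Rmin_left, Rmax_right in H by lra.
  assert (E01 : forall x, (0 + RtoC x * 1)%C = RtoC x) by (intros; ring).
  assert (H1 : forall x, a <= x <= t -> @is_derive R_AbsRing C_R_NormedModule
    (fun x => G (0 + RtoC x * 1)%C) x (RtoC (v x) * 1)%C).
  { intros x Hx. apply cderiv_along. rewrite E01. now apply HG. }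
  assert (H2 : forall x, a <= x <= t -> pcont (fun x => (RtoC (v x) * 1)%C) x).
  { intros x Hx. apply continuous_Cmult; [| apply continuous_const ].
    now apply continuous_RtoC, HG. }
  specialize (H H1 H2). rewrite !E01 in H.
  apply is_RInt_Re_Im in H. destruct H as [HR HI].
  assert (ER : RInt v a t = Re (G (RtoC t) - G (RtoC a))%C).
  { apply is_RInt_unique. eapply is_RInt_ext; [| exact HR ].
    intros x _. simpl. ring. }
  assert (EI : 0 = Im (G (RtoC t) - G (RtoC a))%C).
  { assert (H0 := @is_RInt_const R_NormedModule a t 0).
    change (scal (t - a) 0) with ((t - a) * 0) in H0. rewrite Rmult_0_r in H0.
    rewrite <- (is_RInt_unique _ _ _ _ H0). apply is_RInt_unique.
    eapply is_RInt_ext; [| exact HI ]. intros x _. simpl. ring. }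
  rewrite ER. unfold Re, Im in *. simpl in *.
  destruct (G (RtoC t)) as [x y], (G (RtoC a)) as [x' y']. simpl in *.
  unfold Cplus, RtoC. simpl. f_equal; lra.
Qed.

Lemma velocity_eq (gamma : R -> C) (phi : C -> C) (a b t : R) (l : C) :
  (forall x, a <= x <= b -> phi (RtoC x) = gamma x) -> a < t < b ->
  cderiv phi (RtoC t) l -> velocity gamma t = l.
Proof.
  intros Hg Ht Hl.
  assert (E01 : forall x, (0 + RtoC x * 1)%C = RtoC x) by (intros; ring).
  assert (H : @is_derive R_AbsRing C_R_NormedModule gamma t l).
  { rewrite <- (Cmult_1_r l).
    apply is_derive_ext_loc with (f := fun x => phi (0 + RtoC x * 1)%C).
    - assert (Hd : 0 < Rmin (t - a) (b - t)) by (apply Rmin_glb_lt; lra).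
      exists (mkposreal _ Hd). intros x Hx.
      assert (Hx' : Rabs (x - t) < Rmin (t - a) (b - t)) by exact Hx.
      apply Rabs_lt_between in Hx'.
      assert (M1 := Rmin_l (t - a) (b - t)). assert (M2 := Rmin_r (t - a) (b - t)).
      rewrite E01. apply Hg. lra.
    - apply cderiv_along. now rewrite E01. }
  unfold velocity. destruct l as [u v]. f_equal; apply is_derive_unique.
  - exact (filterdiff_comp' gamma (fun z : C_R_NormedModule => Re z) t _ _ H
      (filterdiff_linear _ (@is_linear_fst R_AbsRing R_NormedModule R_NormedModule))).
  - exact (filterdiff_comp' gamma (fun z : C_R_NormedModule => Im z) t _ _ H
      (filterdiff_linear _ (@is_linear_snd R_AbsRing R_NormedModule R_NormedModule))).
Qed.

(** The primitive of the extended speed extends the arc length, and is injective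
    because its derivative has a positive real part. *)
Lemma arc_length_extension (a b : R) (gamma : R -> C) (V : C -> Prop) (phi : C -> C) (s0 : R) :
  a < b -> open V -> contains_segment V a b -> conformal_on V phi ->
  (forall t, a <= t <= b -> phi (RtoC t) = gamma t) ->
  exists h G G1, 0 < h /\
    (forall z, rectangle (a - h) (b + h) h z -> V z /\ cderiv G z (G1 z) /\ G1 z <> 0) /\
    (forall z w, rectangle (a - h) (b + h) h z -> rectangle (a - h) (b + h) h w ->
       G z = G w -> z = w) /\
    (forall t, a <= t <= b -> G (RtoC t) = RtoC (arc_length gamma a s0 t) /\
       G1 (RtoC t) = RtoC (Cmod (C_derive phi (RtoC t)))).
Proof.
  intros Hab HV Hseg Hphi Hgam.
  destruct (speed_extension a b V phi Hab HV Hseg Hphi) as [h [g [Hh [Hg Hgt]]]].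
  set (K := closed_rectangle (a - h) (b + h) h) in *.
  assert (HK := closed_rectangle_convex (a - h) (b + h) h).
  assert (HKc := closed_rectangle_closed (a - h) (b + h) h). fold K in HK, HKc.
  set (U := rectangle (a - h) (b + h) h).
  assert (HUK : forall z, U z -> K z).
  { intros z [H1 H2]. split; lra. }
  assert (HUx : forall t, a <= t <= b -> U (RtoC t)).
  { intros t Ht. split; simpl; lra. }
  assert (HgK : forall z, K z -> holo g z) by (intros; now apply Hg).
  set (G := fun w => (RtoC s0 + seg g (RtoC a) w)%C).
  assert (HG : forall z, U z -> cderiv G z (g z)).
  { intros z Hz. replace (g z) with (0 + g z)%C by ring.
    apply cderiv_plus; [ apply cderiv_const |].
    apply (seg_primitive K); auto; [ apply HUK, HUx; lra |].
    destruct (rectangle_open _ _ _ _ Hz) as [d [Hd H]]. exists d. split; [ exact Hd |].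
    intros w Hw. now apply HUK, H. }
  exists h, G, g. split; [ exact Hh | split; [| split ] ].
  - intros z Hz. split; [ now apply Hg, HUK | split; [ now apply HG |] ].
    now apply Re_pos_neq_0, Hg, HUK.
  - intros z w Hz Hw.
    assert (HUseg : forall t, 0 <= t <= 1 -> U (z + RtoC t * (w - z))%C).
    { intros t Ht. now apply rectangle_convex. }
    apply (Re_derivative_pos_injective g G).
    + intros t Ht. now apply holo_continuous, HgK, HUK, HUseg.
    + intros t Ht. split; [ now apply HG, HUseg | now apply Hg, HUK, HUseg ].
  - intros t Ht. split; [| now apply Hgt ].
    assert (Hv : forall x, a <= x <= b -> Re (g (RtoC x)) = Cmod (C_derive phi (RtoC x))).
    { intros x Hx. now rewrite Hgt. }
    rewrite (real_primitive G (fun x => Re (g (RtoC x))) a t).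
    + unfold arc_length. rewrite RtoC_plus.
      replace (G (RtoC a)) with (RtoC s0).
      2:{ unfold G, seg. replace (RtoC a - RtoC a)%C with (RtoC 0) by ring. ring. }
      f_equal. f_equal. apply RInt_ext. intros x Hx.
      rewrite Rmin_left, Rmax_right in Hx by lra.
      rewrite Hv by lra. f_equal. symmetry. apply (velocity_eq gamma phi a b); auto; [ lra |].
      apply (conformal_cderiv V); auto. apply Hseg. lra.
    + lra.
    + intros x Hx. split.
      * rewrite Hv, <- Hgt by lra. apply HG, HUx. lra.
      * apply continuous_Re. apply (continuous_comp RtoC g).
        -- apply (continuous_RtoC (fun t : R => t)), continuous_id.
        -- apply holo_continuous, HgK, HUK, HUx. lra.
Qed.

Lemma straddle_ext (f g : R -> C) (a b t : R) (l : C) :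
  (forall x, a <= x <= b -> f x = g x) -> straddle f a b t l -> straddle g a b t l.
Proof.
  intros E H e He. destruct (H e He) as [d [Hd Hw]]. exists d. split; [ exact Hd |].
  intros u v Hu Hv H1 H2. rewrite <- !E by lra. now apply Hw.
Qed.

Lemma intermediate_value (F : C -> C) (s : R -> R) (a b x : R) :
  a < b -> (forall t, a <= t <= b -> ccont F (RtoC t) /\ F (RtoC t) = RtoC (s t)) ->
  s a <= x <= s b -> exists t, a <= t <= b /\ s t = x.
Proof.
  intros Hab HF [[Hx1 | <-] [Hx2 | ->]];
    [| exists b; lra | exists a; lra | exists b; lra ].
  assert (HRe : forall t, a <= t <= b -> Re (F (RtoC t)) = s t).
  { intros t Ht. now rewrite (proj2 (HF t Ht)). }
  destruct (Ranalysis5.IVT_interv (fun t => Re (F (RtoC t)) - x) a b) as [t [Ht E]].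
  - intros t Ht. apply continuity_pt_filterlim.
    apply (@continuous_minus R_UniformSpace R_AbsRing R_NormedModule);
      [| apply continuous_const ].
    apply continuous_Re, (continuous_comp RtoC F);
      [ apply (continuous_RtoC (fun t : R => t)), continuous_id | now apply HF ].
  - exact Hab.
  - rewrite HRe by lra. lra.
  - rewrite HRe by lra. lra.
  - exists t. rewrite HRe in E by exact Ht. split; [ exact Ht | lra ].
Qed.

(** The image of [U] is a neighbourhood of the real segment [[s a, s b]], and so
    contains a rectangle around it. *)
Lemma inverse_on_rectangle (U : C -> Prop) (G G1 : C -> C) (s : R -> R) (a b : R) :
  a < b -> open U -> (forall z, U z -> cderiv G z (G1 z) /\ G1 z <> 0) ->
  (forall z w, U z -> U w -> G z = G w -> z = w) ->
  (forall t, a <= t <= b -> U (RtoC t) /\ G (RtoC t) = RtoC (s t)) -> s a <= s b ->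
  exists h g, 0 < h /\ (forall z, U z -> g (G z) = z) /\
    (forall w, rectangle (s a - h) (s b + h) h w -> exists z, U z /\ G z = w /\ holo g w).
Proof.
  intros Hab HU HG Hinj Hs Hsab.
  set (g := fun w => epsilon (inhabits (RtoC 0)) (fun z => U z /\ G z = w)).
  assert (Hg : forall z, U z -> g (G z) = z).
  { intros z Hz. assert (H : U (g (G z)) /\ G (g (G z)) = G z).
    { apply (epsilon_spec (inhabits (RtoC 0)) (fun x => U x /\ G x = G z)). now exists z. }
    apply Hinj; tauto. }
  destruct (segment_neighbourhood (fun w => exists z, U z /\ G z = w) (s a) (s b) Hsab)
    as [h [Hh Hw]].
  { intros x Hx. destruct (intermediate_value G s a b x Hab) as [t [Ht <-]]; [| exact Hx |].
    - intros t Ht. destruct (Hs t Ht) as [H1 H2]. split; [| exact H2 ].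
      eapply cderiv_continuous. now apply HG.
    - destruct (Hs t Ht) as [H1 H2].
      destruct (proj1 (open_iff_balls U) HU _ H1) as [d [Hd Hd']].
      destruct (inverse_function G G1 (RtoC t) d Hd) as [r [Hr H]].
      + intros w Hwt. now apply HG, Hd'.
      + now apply HG.
      + exists r. split; [ exact Hr |]. intros w Hwt. rewrite <- H2 in Hwt.
        destruct (H w Hwt) as [z [Hz1 [Hz2 _]]]. exists z. split; [ now apply Hd' | exact Hz2 ]. }
  exists h, g. split; [ exact Hh | split; [ exact Hg |] ].
  intros w [H1 H2]. destruct (Hw w H1 H2) as [z [Hz E]].
  exists z. split; [ exact Hz | split; [ exact E |] ]. rewrite <- E.
  destruct (proj1 (open_iff_balls U) HU _ Hz) as [d [Hd Hd']].
  apply (cderiv_inverse U G G1 g z d Hd); [| now apply HG | exact Hg ].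
  intros u Hu. split; [ now apply Hd' | now apply HG, Hd' ].
Qed.

Theorem mainTheorem1 (a b : R) (hab : a < b) (gamma : R -> C)
    (hgamma : analytic_curve gamma a b) (s0 : R) :
  let L : R := real (curve_length gamma a b) in
  let s : R -> R := arc_length gamma a s0 in
  (* L is a positive real number and s maps [a,b] into [s0, s0 + L] *)
  (is_finite (curve_length gamma a b) /\ 0 < L /\
   (forall t : R, a <= t <= b -> s0 <= s t <= s0 + L)) /\
  (* (i) *)
  (exists (V : C -> Prop) (G : C -> C),
     open V /\ contains_segment V a b /\ conformal_on V G /\
     (forall t : R, a <= t <= b -> G (RtoC t) = RtoC (s t))) /\
  (* (ii) *)
  (exists (O : C -> Prop) (delta : C -> C),
     open O /\ contains_segment O s0 (s0 + L) /\ conformal_on O delta /\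
     (forall t : R, a <= t <= b -> gamma t = delta (RtoC (s t))) /\
     symmetric_rectangle O) /\
  (* (iii) *)
  (forall (O : C -> Prop) (delta : C -> C),
     open O -> contains_segment O s0 (s0 + L) -> conformal_on O delta ->
     (forall t : R, a <= t <= b -> gamma t = delta (RtoC (s t))) ->
     forall (s0' : R) (O' : C -> Prop) (delta' : C -> C),
       open O' -> contains_segment O' s0' (s0' + L) -> conformal_on O' delta' ->
       (forall t : R, a <= t <= b ->
          gamma t = delta' (RtoC (s t + (s0' - s0)))) ->
       forall x : R, s0 <= x <= s0 + L ->
         delta' (RtoC (x + s0' - s0)) = delta (RtoC x)).

Proof.
  intros L s.
  destruct hgamma as [_ [V [phi [HV [Hseg [Hphi Hgam]]]]]].
  destruct (arc_length_extension a b gamma V phi s0 hab HV Hseg Hphi Hgam)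
    as [h [G [G1 [Hh [HG [Hinj HGt]]]]]].
  fold s in HGt. set (U := rectangle (a - h) (b + h) h) in *.
  assert (HUx : forall t, a <= t <= b -> U (RtoC t)) by (intros t Ht; split; simpl; lra).
  assert (HUo : open U) by (apply open_iff_balls; intros z; apply rectangle_open).
  assert (Hspeed : integrates_speed gamma s a b).
  { intros t Ht. exists (C_derive phi (RtoC t)). split.
    - apply straddle_ext with (1 := Hgam), cderiv_straddle, (conformal_cderiv V); auto.
    - destruct (HGt t Ht) as [_ <-].
      apply straddle_ext with (1 := fun x Hx => proj1 (HGt x Hx)), cderiv_straddle.
      now apply HG, HUx. }
  assert (Hsa : s a = s0).
  { unfold s, arc_length. rewrite RInt_point. apply Rplus_0_r. }
  assert (Hlen : curve_length gamma a b = Finite (s b - s0)).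
  { rewrite <- Hsa. now apply curve_length_speed; [| apply Rlt_le ]. }
  assert (HL : L = s b - s0) by (unfold L; now rewrite Hlen).
  assert (Hsb : s b = s0 + L) by lra.
  assert (Hmono : forall x y, a <= x -> x <= y -> y <= b -> s x <= s y).
  { intros x y H1 H2 H3. assert (H := chord_le gamma s a b x y Hspeed H1 H2 H3).
    assert (P := Cmod_ge_0 (gamma y - gamma x)). lra. }
  assert (HL0 : 0 < L).
  { assert (H := chord_le gamma s a b a b Hspeed ltac:(lra) ltac:(lra) ltac:(lra)).
    assert (P : 0 < Cmod (gamma b - gamma a)).
    { apply Cmod_neq_pos. intros E. rewrite <- !Hgam in E by lra.
      apply Hphi in E; [| apply Hseg; lra | apply Hseg; lra ].
      apply RtoC_inj in E. lra. }
    lra. }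
  assert (Hivt : forall x, s0 <= x <= s0 + L -> exists t, a <= t <= b /\ s t = x).
  { intros x Hx. apply (intermediate_value G s a b x hab); [| lra ].
    intros t Ht. split; [| now apply HGt ].
    eapply cderiv_continuous. now apply HG, HUx. }
  split; [| split; [| split ] ].
  - split; [ now rewrite Hlen | split; [ exact HL0 |] ]. intros t Ht.
    assert (H1 := Hmono a t ltac:(lra) ltac:(lra) ltac:(lra)).
    assert (H2 := Hmono t b ltac:(lra) ltac:(lra) ltac:(lra)). lra.
  - exists U, G. split; [ exact HUo | split; [ exact HUx | split ] ].
    + apply conformal_intro; [| exact Hinj ]. intros z Hz. eexists. now apply HG.
    + intros t Ht. now apply HGt.
  - destruct (inverse_on_rectangle U G G1 s a b hab HUo) as [k [g [Hk [Hg Hw]]]].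
    + intros z Hz. now apply HG.
    + exact Hinj.
    + intros t Ht. split; [ now apply HUx | now apply HGt ].
    + apply Hmono; lra.
    + exists (rectangle (s a - k) (s b + k) k), (fun w => phi (g w)).
      split; [| split; [| split; [| split ] ] ].
      * apply open_iff_balls. intros z. apply rectangle_open.
      * intros x Hx. split; simpl; lra.
      * apply conformal_intro.
        -- intros w Hwr. destruct (Hw w Hwr) as [z [Hz [E [l Hl]]]].
           eexists. apply cderiv_comp; [| exact Hl ].
           apply (conformal_cderiv V); auto. rewrite <- E, Hg by exact Hz. now apply HG.
        -- intros w w' H1 H2 E.
           destruct (Hw w H1) as [z [Hz [<- _]]], (Hw w' H2) as [z' [Hz' [<- _]]].
           rewrite !Hg in E by assumption. f_equal. apply Hphi; auto; now apply HG.
      * intros t Ht. destruct (HGt t Ht) as [<- _].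
        rewrite Hg by now apply HUx. symmetry. now apply Hgam.
      * exists (s a - k), (s b + k), k. split; [ lra | split; [ exact Hk |] ].
        intros z. reflexivity.
  - intros O delta _ _ _ Hdelta s0' O' delta' _ _ _ Hdelta' x Hx.
    destruct (Hivt x Hx) as [t [Ht <-]].
    rewrite <- Hdelta, Hdelta' by exact Ht. do 2 f_equal. ring.
Qed.
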